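(* (Global Hölder estimates) Let $\mathcal M_{\mathbf a}\in\mathcal A$, let $\Omega\subset\mathbb R^n$ be a bounded domain, let $f$ be continuous and bounded in $\Omega$, and let $u\in C(\overline\Omega)$ be a viscosity solution of the equation $\mathcal M_{\mathbf a}(D^2u)=f$ in $\Omega$. Let $\alpha\in(0,1)$ be the exponent of the interior $C^\alpha$ estimates for $\mathcal M_{\mathbf a}$ (as defined in the context). (i) Suppose that $\Omega$ satisfies the uniform exterior sphere condition (S) with radius $R>0$: for all $y\in\partial\Omega$ there is a ball $B_R$ of radius $R$ such that $y\in\partial B_R$ and $\overline\Omega\subset\overline B_R$. If $u=g$ on $\partial\Omega$ with $g\in C^\beta(\partial\Omega)$ and $\beta\in(0,1]$, then $u\in C^\gamma(\overline\Omega)$ with $\gamma=\min(\alpha,\beta/2)$, and $$[u]_{\gamma,\Omega}\le C\left(\|g\|_{C^\beta(\partial\Omega)}+\|f\|_{L^\infty(\Omega)}\right),$$ where $C$ is a positive constant depending only on $n$, $a^*$, $\tilde a$, $R$ and $\beta$. (ii) Suppose in addition to condition (S) that $\Omega$ has a uniform Lipschitz boundary with Lipschitz constant $L$. If $u=g$ on $\partial\Omega$ with $g\in C^{1,\beta}(\partial\Omega)$ and $\beta\in[0,1)$, then $u\in C^\gamma(\overline\Omega)$ with $\gamma=\min(\alpha,(1+\beta)/2)$, and $$[u]_{\gamma,\Omega}\le C\left(\|g\|_{C^{1,\beta}(\partial\Omega)}+\|f\|_{L^\infty(\Omega)}\right),$$ where $C$ is a positive constant depending only on $n$, $a^*$,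 $\tilde a$, $R$, $L$ and $\beta$.
   Context: For a real symmetric $n\times n$ matrix $X\in\mathcal S^n$, let $\lambda_1(X)\le\dots\le\lambda_n(X)$ be its eigenvalues. For $\mathbf a=(a_1,\dots,a_n)$ with $a_i\ge0$ for all $i$ and at least one $a_j>0$, set $\mathcal M_{\mathbf a}(X)=\sum_{i=1}^n a_i\lambda_i(X)$. $\mathcal A$ is the class of such operators with $a_1>0$ and $a_n>0$; $a^*=\min(a_1,a_n)$ and $\tilde a=(a_1+\dots+a_n)/n$. Exponent of the interior estimates: $\alpha\in(0,1)$ is an exponent, depending only on $n$, $a^*$, $\tilde a$, for which there is a constant $C_0>0$, depending only on $n$, $a^*$, $\tilde a$, such that for all concentric balls $B_1$, $B_{1/2}$ of radius $1$ and $1/2$, every viscosity solution $w$ of $\mathcal M_{\mathbf a}(D^2w)=h$ in $B_1$ with $h$ continuous and bounded satisfies $\|w\|_{C^\alpha(\overline B_{1/2})}\le C_0(\|w\|_{L^\infty(B_1)}+\|h\|_{L^n(B_1)})$. Hölder notation: for $h:D\to\mathbb R$, $D\subset\mathbb R^n$, $[h]_{\gamma,D}=\sup_{x\ne y\in D}|h(x)-h(y)|/|x-y|^\gamma$ (same for vector-valued $h$). $\|g\|_{C^\beta(\partial\Omega)}=\sup_{\partial\Omega}|g|+[g]_{\beta,\partial\Omega}$. $g\in C^{1,\beta}(\partial\Omega)$ means that $g$ is the restriction of a $C^{1,\beta}$ function defined near $\partial\Omega$, $Dg$ denotes its gradient, and $\|g\|_{C^{1,\beta}(\partial\Omega)}=\sup_{\partial\Omega}|g|+\sup_{\partial\Omega}|Dg|+[Dg]_{\beta,\partial\Omega}$.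 Viscosity notions: for an open set $\Omega$, an upper semicontinuous $u$ is a viscosity subsolution of $\mathcal M_{\mathbf a}(D^2u)=f$ (also written $\mathcal M_{\mathbf a}(D^2u)\ge f$) in $\Omega$ if $\mathcal M_{\mathbf a}(X)\ge f(x)$ for all $x\in\Omega$ and all $(\xi,X)\in\mathbb R^n\times\mathcal S^n$ such that $u(y)\le u(x)+\langle\xi,y-x\rangle+\frac12\langle X(y-x),y-x\rangle+o(|y-x|^2)$ as $y\to x$. A lower semicontinuous $u$ is a viscosity supersolution (written $\mathcal M_{\mathbf a}(D^2u)\le f$) if $\mathcal M_{\mathbf a}(X)\le f(x)$ for all $x\in\Omega$ and all $(\xi,X)$ such that $u(y)\ge u(x)+\langle\xi,y-x\rangle+\frac12\langle X(y-x),y-x\rangle+o(|y-x|^2)$ as $y\to x$. A viscosity solution is a continuous function that is both a sub- and a supersolution.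
   Formalization: Part (ii) is stated for n ≥ 2 only; for n = 1 it is false: on Ω = (0,ε) with f = 0, g = 0 near 0 and g = 1 near ε, the C^{1,β} norm of g is 1 while [u]_γ = ε^{-γ} is unbounded. *)

(* Defs.v *)
From HB Require Import structures.
From mathcomp Require Import all_boot all_order all_algebra.
From mathcomp Require Import all_classical all_reals all_analysis.

Set Implicit Arguments.
Unset Strict Implicit.
Unset Printing Implicit Defensive.

Import Order.TTheory GRing.Theory Num.Theory.
Import numFieldNormedType.Exports.

Local Open Scope classical_set_scope.
Local Open Scope ring_scope.

Section lebesgue_measure_Rn.
Context {R : realType}.
Local Open Scope ereal_scope.

Local Notation RT n := (n.-tuple (measurableTypeR R)).

Definition tuple_cons n (p : measurableTypeR R * RT n) : RT n.+1 :=
  [tuple of p.1 :: p.2].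

Definition tuple_uncons n (t : RT n.+1) : measurableTypeR R * RT n :=
  (thead t, [tuple of behead t]).

Lemma tuple_consK n : cancel (@tuple_cons n) (@tuple_uncons n).
Proof.
case=> x t; apply/pair_equal_spec; split=> /=; first exact: theadE.
exact/val_inj.
Qed.

Lemma measurable_tuple_cons n : measurable_fun [set: _] (@tuple_cons n).
Proof. exact: measurable_cons. Qed.

Lemma measurable_tuple_uncons n : measurable_fun [set: _] (@tuple_uncons n).
Proof.
apply/measurable_fun_pairP; split.
- exact: (measurable_tnth ord0).
- exact: measurable_behead.
Qed.

Section step.
Variables (n : nat) (mu : {sigma_finite_measure set (RT n) -> \bar R}).

Definition lebesgue_tupleS :=
  pushforward (@lebesgue_measure R \x mu) (@tuple_cons n).

Let lebesgue_tupleS0 : lebesgue_tupleS set0 = 0.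
Proof. by rewrite /lebesgue_tupleS /pushforward preimage_set0 measure0. Qed.

Let lebesgue_tupleS_ge0 A : 0 <= lebesgue_tupleS A.
Proof. by rewrite /lebesgue_tupleS /pushforward; exact: measure_ge0. Qed.

Let lebesgue_tupleS_sigma_additive : semi_sigma_additive lebesgue_tupleS.
Proof.
have mc A : measurable A -> measurable (@tuple_cons n @^-1` A).
  by move=> mA; rewrite -[X in measurable X]setTI; exact: measurable_tuple_cons.
move=> F mF tF mUF; rewrite /lebesgue_tupleS /pushforward preimage_bigcup.
apply: measure_semi_sigma_additive; first by move=> k; exact: mc.
- apply/trivIsetP => i j _ _ ij; rewrite -preimage_setI.
  by move/trivIsetP : tF => /(_ _ _ _ _ ij) -> //; rewrite preimage_set0.
- by rewrite -preimage_bigcup; exact: mc.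
Qed.

HB.instance Definition _ := isMeasure.Build _ _ _ lebesgue_tupleS
  lebesgue_tupleS0 lebesgue_tupleS_ge0 lebesgue_tupleS_sigma_additive.

Let lebesgue_tupleS_sigma_finite : sigma_finite setT lebesgue_tupleS.
Proof.
have /sigma_finiteP[F [FT ndF mF]] := sigma_finiteT (@lebesgue_measure R).
have /sigma_finiteP[G [GT ndG mG]] := sigma_finiteT mu.
exists (fun k => @tuple_uncons n @^-1` (F k `*` G k)).
  rewrite -preimage_bigcup (_ : \bigcup_k _ = setT) ?preimage_setT//.
  apply/seteqP; split=> // -[x t] _.
  have [k _ Fkx] : (\bigcup_k F k) x by rewrite -FT.
  have [l _ Glt] : (\bigcup_k G k) t by rewrite -GT.
  exists (maxn k l) => //; split => /=.
  - by move: Fkx; exact/subsetPset/ndF/leq_maxl.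
  - by move: Glt; exact/subsetPset/ndG/leq_maxr.
move=> k; have [mFk Fk] := mF k; have [mGk Gk] := mG k; split.
  rewrite -[X in measurable X]setTI; apply: measurable_tuple_uncons => //.
  exact: measurableX.
rewrite /lebesgue_tupleS /pushforward -comp_preimage.
rewrite (_ : _ \o _ = id) ?preimage_id; last first.
  by apply/funext => p /=; rewrite tuple_consK.
by rewrite product_measure1E// lte_mul_pinfty// ge0_fin_numE.
Qed.

HB.instance Definition _ := @Measure_isSigmaFinite.Build _ _ _ lebesgue_tupleS
  lebesgue_tupleS_sigma_finite.

End step.

(* n-dimensional Lebesgue (Borel) measure, as an iterated product measure. *)
Fixpoint lebesgue_tuple n : {sigma_finite_measure set (RT n) -> \bar R} :=
  if n is n'.+1 then lebesgue_tupleS (lebesgue_tuple n')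
  else \d_ ([tuple] : RT 0).

Lemma lebesgue_tuple_box n (A : 'I_n -> set (measurableTypeR R)) :
  (forall i, measurable (A i)) ->
  lebesgue_tuple n [set t | forall i, A i (tnth t i)] =
  \prod_(i < n) lebesgue_measure (A i).
Proof.
elim: n A => [|n IH] A mA.
  by rewrite big_ord0 /= diracE mem_set// => -[].
rewrite big_ord_recl -(IH (fun i => A (lift ord0 i))) //=.
rewrite /lebesgue_tupleS /pushforward -product_measure1E//; last first.
  rewrite (_ : [set t | _] =
      \bigcap_(i in [set: 'I_n]) ((@tnth n _)^~ i @^-1` A (lift ord0 i))).
    apply: fin_bigcap_measurable => // i _.
    by rewrite -[X in measurable X]setTI; exact: measurable_tnth.
  by apply/seteqP; split=> [t h i _|t h i]; exact: h.
congr (_ _); apply/seteqP; split=> [[x t] /= h|[x t] /= [h0 h] i].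
  split; first exact: (h ord0).
  by move=> i; have := h (lift ord0 i); rewrite tnthS.
by case: (unliftP ord0 i) => [j|] ->; rewrite ?tnthS//; exact: h.
Qed.

End lebesgue_measure_Rn.

Section euclidean.
Context {R : realType}.

(* The canonical norm of 'rV[R]_n is the sup norm; the Euclidean one induces
   the same topology. *)
Definition dotp n (x y : 'rV[R]_n) : R := \sum_i x 0 i * y 0 i.

Definition enorm n (x : 'rV[R]_n) : R := Num.sqrt (dotp x x).

Definition eball n (x : 'rV[R]_n) (r : R) : set 'rV[R]_n :=
  [set y | enorm (y - x) < r].

Definition closed_eball n (x : 'rV[R]_n) (r : R) : set 'rV[R]_n :=
  [set y | enorm (y - x) <= r].

Definition boundary n (A : set 'rV[R]_n) : set 'rV[R]_n :=
  closure A `\` interior A.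

Definition bounded_domain n (Omega : set 'rV[R]_n) :=
  [/\ open Omega, connected Omega, Omega !=set0 & bounded_set Omega].

Definition grad n (g : 'rV[R]_n -> R) (x : 'rV[R]_n) : 'rV[R]_n :=
  \row_i 'D_(delta_mx 0 i) g x.

End euclidean.

Section norms.
Context {R : realType}.
Local Open Scope ereal_scope.

(* L^p norm of h over D with respect to Lebesgue measure; p may be +oo. *)
Definition Lnorm_on n (p : \bar R) (D : set 'rV[R]_n) (h : 'rV[R]_n -> R) :
    \bar R :=
  'N[lebesgue_tuple n]_p[
    (fun t : n.-tuple (measurableTypeR R) =>
       ((EFin \o h) \_ D) (\row_i tnth t i))].

(* N is the norm on values: Num.norm for scalar, enorm for vector functions.
   These suprema are -oo (instead of 0) when D is empty, respectively has at
   most one point. *)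
Definition sup_norm n (V : zmodType) (N : V -> R) (D : set 'rV[R]_n)
    (h : 'rV[R]_n -> V) : \bar R :=
  ereal_sup [set (N (h x))%:E | x in D].

Definition holder_seminorm n (V : zmodType) (N : V -> R) (gamma : R)
    (D : set 'rV[R]_n) (h : 'rV[R]_n -> V) : \bar R :=
  ereal_sup [set (N (h z.1 - h z.2) / enorm (z.1 - z.2) `^ gamma)%:E | z in
    [set z : 'rV[R]_n * 'rV[R]_n | [/\ D z.1, D z.2 & z.1 != z.2]]].

Definition holder_norm n (gamma : R) (D : set 'rV[R]_n)
    (h : 'rV[R]_n -> R) : \bar R :=
  sup_norm Num.norm D h + holder_seminorm Num.norm gamma D h.

Definition C1_holder_norm n (beta : R) (D : set 'rV[R]_n)
    (g : 'rV[R]_n -> R) : \bar R :=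
  sup_norm Num.norm D g + sup_norm (@enorm R n) D (grad g) +
  holder_seminorm (@enorm R n) beta D (grad g).

Definition C1_holder_near n (beta : R) (D : set 'rV[R]_n)
    (g : 'rV[R]_n -> R) :=
  exists U : set 'rV[R]_n,
    [/\ open U, D `<=` U, (forall x, U x -> differentiable g x),
        {within U, continuous (grad g)} &
        holder_seminorm (@enorm R n) beta U (grad g) < +oo].

End norms.

Section domains.
Context {R : realType}.

Definition exterior_sphere n (rad : R) (Omega : set 'rV[R]_n) :=
  forall y, boundary Omega y ->
    exists z, enorm (y - z) = rad /\ closure Omega `<=` closed_eball z rad.

(* After a rigid motion sending y to 0, given by the orthogonal matrix Q,
   Omega is near y the epigraph of phi in the last coordinate. *)
Definition uniform_lipschitz_boundary n (L : R) (Omega : set 'rV[R]_n.+1) :=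
  exists r : R, 0 < r /\ forall y, boundary Omega y ->
    exists (Q : 'M[R]_n.+1) (phi : 'rV[R]_n -> R),
      [/\ Q *m Q^T = 1%:M,
          (forall s t, `|phi s - phi t| <= L * enorm (s - t)) &
          forall x, eball y r x ->
            (Omega x <->
             phi (col' ord_max ((x - y) *m Q)) < ((x - y) *m Q) 0 ord_max)].

End domains.

Section operator.
Context {R : realType}.

(* Ordered eigenvalues, with multiplicity; the default value is irrelevant for
   symmetric X, whose characteristic polynomial splits over R. *)
Definition eigenvals n (X : 'M[R]_n) : n.-tuple R :=
  xget (nseq_tuple n 0)
    [set l : n.-tuple R | sorted <=%R l /\
       char_poly X = \prod_(z <- l) ('X - z%:P)].

Definition Mop n (a : 'I_n -> R) (X : 'M[R]_n) : R :=
  \sum_(i < n) a i * tnth (eigenvals X) i.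

Definition class_A n (a : 'I_n.+1 -> R) :=
  [/\ forall i, 0 <= a i, 0 < a ord0 & 0 < a ord_max].

Definition min_weight n (a : 'I_n.+1 -> R) : R :=
  Num.min (a ord0) (a ord_max).

Definition mean_weight n (a : 'I_n.+1 -> R) : R :=
  (\sum_(i < n.+1) a i) / n.+1%:R.

End operator.

Section viscosity.
Context {R : realType} {n : nat}.
Implicit Types (Omega : set 'rV[R]_n) (u f : 'rV[R]_n -> R).

Definition quadr (x xi : 'rV[R]_n) (X : 'M[R]_n) (y : 'rV[R]_n) : R :=
  dotp xi (y - x) + 2^-1 * dotp ((y - x) *m X) (y - x).

Definition superjet u (x xi : 'rV[R]_n) (X : 'M[R]_n) :=
  forall e : R, 0 < e -> \forall y \near x,
    u y <= u x + quadr x xi X y + e * enorm (y - x) ^+ 2.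

Definition subjet u (x xi : 'rV[R]_n) (X : 'M[R]_n) :=
  forall e : R, 0 < e -> \forall y \near x,
    u x + quadr x xi X y - e * enorm (y - x) ^+ 2 <= u y.

Definition usc_on Omega u := forall x, Omega x ->
  forall e : R, 0 < e -> \forall y \near within Omega (nbhs x), u y < u x + e.

Definition lsc_on Omega u := forall x, Omega x ->
  forall e : R, 0 < e -> \forall y \near within Omega (nbhs x), u x - e < u y.

Definition viscosity_subsolution (a : 'I_n -> R) Omega f u :=
  usc_on Omega u /\
  forall x, Omega x -> forall (xi : 'rV[R]_n) (X : 'M[R]_n),
    X^T = X -> superjet u x xi X -> f x <= Mop a X.

Definition viscosity_supersolution (a : 'I_n -> R) Omega f u :=
  lsc_on Omega u /\
  forall x, Omega x -> forall (xi : 'rV[R]_n) (X : 'M[R]_n),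
    X^T = X -> subjet u x xi X -> Mop a X <= f x.

Definition viscosity_solution (a : 'I_n -> R) Omega f u :=
  [/\ {within Omega, continuous u}, viscosity_subsolution a Omega f u &
      viscosity_supersolution a Omega f u].

End viscosity.

Definition bounded_continuous (R : realType) n (D : set 'rV[R]_n)
    (h : 'rV[R]_n -> R) :=
  {within D, continuous h} /\ [bounded h x | x in D].

(* The dimension is n.+1. *)
Definition interior_exponent (R : realType) (n : nat)
    (astar atilde alpha : R) :=
  0 < alpha < 1 /\
  exists C0 : R, 0 < C0 /\
    forall (a : 'I_n.+1 -> R) (x0 : 'rV[R]_n.+1) (w h : 'rV[R]_n.+1 -> R),
      class_A a -> min_weight a = astar -> mean_weight a = atilde ->
      bounded_continuous (eball x0 1) h ->
      viscosity_solution a (eball x0 1) h w ->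
      (holder_norm alpha (closed_eball x0 2^-1) w <=
       C0%:E * (Lnorm_on +oo (eball x0 1) w +
                Lnorm_on n.+1%:R%:E (eball x0 1) h))%E.

(* Main.v *)
Require Import Defs.
From HB Require Import structures.
From mathcomp Require Import all_boot all_order all_algebra.
From mathcomp Require Import all_classical all_reals all_analysis.
From mathcomp Require Import ess_sup_inf hoelder.
From mathcomp Require Import ring lra.

(** Why the estimates hold.

    Let y be a boundary point, nu the unit vector from the center of its
    sphere to y, and let h(x) = <nu, y - x> be the height of x over the tangent
    hyperplane at y.  The sphere condition says exactly that
    |x - y|^2 <= 2 R h(x) on the closure of Omega, while h(x) <= |x - y|.  So
    a power h^k of the height is at the same time a modulus of continuity at y
    of exponent k and an upper bound for |x - y|^(2k): this is where half of
    the boundary regularity is lost.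

    Boundary estimate.  Functions of h alone have a rank one Hessian, on which
    the operator only sees a_1 (concave functions) or a_n (convex functions).
    Hence, if u is within K h^k of an affine function on the boundary, then it
    is within (2 K + C |f|) h^k of it in the whole closure.  To avoid
    differentiating h^k, the comparison at a given point is made with the
    quadratic polynomial in h that consists of an affine majorant of K h^k and
    of the term c h (2 R - h), which absorbs f ([quadratic_comparison],
    [two_sided_barrier]).

    In part (i), the affine function is the constant g(y) and k = beta / 2.
    In part (ii), it is the expansion g(y) + <Dg(y), x - y> and
    k = (1 + beta) / 2, so one needs an error of order h(x)^k, or
    T^(1 + beta) with T = sqrt (2 R h(x)), for boundary points x.  The norm of g
    only controls Dg on the boundary, so x and y must be joined on the
    boundary by a path of length O(T); this path may be much longer than
    |x - y|, but it is short enough.  By the sphere condition Omega is convex,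
    and the projection on its closure is a contraction that sends the
    complement of Omega to the boundary.  It is then enough to go around Omega
    from x to y: three segments of length O(T), built from the two normals and
    from a direction orthogonal to the normal at x, do this
    ([boundary_projection], [boundary_expansion]).

    Interior.  The two boundary estimates extend to Hölder continuity in the
    closure by rescaling the interior estimate to the largest ball around each
    point ([rescaled_interior_estimate], [holder_of_boundary_holder]).  The
    equation is homogeneous under this rescaling because the operator is, and
    the L^n norm of the right-hand side on the unit ball is bounded by its
    supremum. *)

Set Implicit Arguments.
Unset Strict Implicit.
Unset Printing Implicit Defensive.

Import Order.TTheory GRing.Theory Num.Theory.
Import numFieldNormedType.Exports.

Local Open Scope classical_set_scope.
Local Open Scope ring_scope.

(** * Euclidean norm and topology *)

Section euclidean_space.
Context {R : realType} {n : nat}.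
Implicit Types (x y z v : 'rV[R]_n) (a r e : R).

Lemma dotpC x y : dotp x y = dotp y x.
Proof. by apply: eq_bigr => i _; rewrite mulrC. Qed.

Lemma dotpDl x y z : dotp (x + y) z = dotp x z + dotp y z.
Proof. by rewrite -big_split; apply: eq_bigr => i _; rewrite mxE mulrDl. Qed.

Lemma dotpZl a x y : dotp (a *: x) y = a * dotp x y.
Proof. by rewrite mulr_sumr; apply: eq_bigr => i _; rewrite mxE mulrA. Qed.

Lemma dotpDr x y z : dotp z (x + y) = dotp z x + dotp z y.
Proof. by rewrite dotpC dotpDl !(dotpC z). Qed.

Lemma dotpZr a x y : dotp x (a *: y) = a * dotp x y.
Proof. by rewrite dotpC dotpZl dotpC. Qed.

Lemma dotpNl x y : dotp (- x) y = - dotp x y.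
Proof. by rewrite -scaleN1r dotpZl mulN1r. Qed.

Lemma dotpNr x y : dotp x (- y) = - dotp x y.
Proof. by rewrite dotpC dotpNl dotpC. Qed.

Lemma dotpBr x y z : dotp z (x - y) = dotp z x - dotp z y.
Proof. by rewrite dotpDr dotpNr. Qed.

Definition dotpE :=
  (dotpDl, dotpDr, dotpNl, dotpNr, dotpZl, dotpZr).

Lemma dotp0l x : dotp 0 x = 0.
Proof. by rewrite -[0](scale0r x) dotpZl mul0r. Qed.

Lemma dotp_ge0 x : 0 <= dotp x x.
Proof. by apply: sumr_ge0 => i _; rewrite -expr2 sqr_ge0. Qed.

Lemma dotp_eq0 x : (dotp x x == 0) = (x == 0).
Proof.
apply/eqP/eqP => [x0|->]; last by rewrite dotp0l.
apply/rowP => i; rewrite mxE; apply/eqP; rewrite -sqrf_eq0 expr2.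
have := @psumr_eq0P _ 'I_n predT (fun i => x 0 i * x 0 i).
move=> H; apply/eqP; apply: H => // j _; by rewrite -expr2 sqr_ge0.
Qed.

Lemma enorm_ge0 x : 0 <= enorm x. Proof. exact: sqrtr_ge0. Qed.
#[local] Hint Extern 0 (is_true (0 <= enorm _)) => exact: enorm_ge0 : core.

Lemma sqr_enorm x : enorm x ^+ 2 = dotp x x.
Proof. by rewrite sqr_sqrtr// dotp_ge0. Qed.

Lemma enorm_eq0 x : (enorm x == 0) = (x == 0).
Proof. by rewrite -sqrf_eq0 sqr_enorm dotp_eq0. Qed.

Lemma enorm0 : enorm (0 : 'rV[R]_n) = 0.
Proof. by apply/eqP; rewrite enorm_eq0. Qed.

Lemma enorm_gt0 x : (0 < enorm x) = (x != 0).
Proof. by rewrite lt_neqAle enorm_ge0 andbT eq_sym enorm_eq0. Qed.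

Lemma enormZ a x : enorm (a *: x) = `|a| * enorm x.
Proof.
by rewrite /enorm !dotpE mulrA -expr2 sqrtrM ?sqr_ge0// sqrtr_sqr.
Qed.

Lemma enormN x : enorm (- x) = enorm x.
Proof. by rewrite -scaleN1r enormZ normrN1 mul1r. Qed.

Lemma enormB x y : enorm (x - y) = enorm (y - x).
Proof. by rewrite -enormN opprB. Qed.

Lemma sqr_enormD x y :
  enorm (x + y) ^+ 2 = enorm x ^+ 2 + 2 * dotp x y + enorm y ^+ 2.
Proof. rewrite !sqr_enorm !dotpE (dotpC y x); ring. Qed.

Lemma sqr_enormB x y :
  enorm (x - y) ^+ 2 = enorm x ^+ 2 - 2 * dotp x y + enorm y ^+ 2.
Proof. rewrite !sqr_enorm !dotpE (dotpC y x); ring. Qed.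

Lemma le_of_sqr a r : 0 <= r -> a ^+ 2 <= r ^+ 2 -> a <= r.
Proof.
move=> r0 h; case: (leP a 0) => a0; first exact: le_trans a0 r0.
by move: h; rewrite ler_pXn2r// nnegrE ltW.
Qed.

(** Expand the squared length of |x|^2 y - <x, y> x. *)
Lemma dotp_le_enorm x y : dotp x y <= enorm x * enorm y.
Proof.
have [->|x0] := eqVneq x 0; first by rewrite dotp0l enorm0 mul0r.
have {}x0 : 0 < enorm x by rewrite enorm_gt0.
apply: le_of_sqr; first exact: mulr_ge0.
have := dotp_ge0 (enorm x ^+ 2 *: y - dotp x y *: x).
rewrite !dotpE -!sqr_enorm (dotpC y x) => h.
have {}h : 0 <= enorm x ^+ 2 * ((enorm x * enorm y) ^+ 2 - dotp x y ^+ 2).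
  apply: le_trans h _; rewrite le_eqVlt; apply/orP; left; apply/eqP; ring.
by move: h; rewrite pmulr_rge0 ?exprn_gt0// subr_ge0.
Qed.

Lemma norm_dotp_le x y : `|dotp x y| <= enorm x * enorm y.
Proof.
rewrite ler_norml dotp_le_enorm andbT lerNl -dotpNl.
by rewrite -(enormN x) dotp_le_enorm.
Qed.

Lemma ler_enormD x y : enorm (x + y) <= enorm x + enorm y.
Proof.
apply: le_of_sqr; first exact: addr_ge0.
rewrite sqr_enormD; have := dotp_le_enorm x y; nra.
Qed.

Lemma enorm_dist_triangle y x z : enorm (x - z) <= enorm (x - y) + enorm (y - z).
Proof. by rewrite -[x - z](_ : (x - y) + (y - z) = _) ?ler_enormD// addrA subrK. Qed.

Lemma coord_le_enorm x i : `|x 0 i| <= enorm x.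
Proof.
rewrite -sqrtr_sqr; apply: ler_wsqrtr; rewrite /dotp (bigD1 i)//= expr2 lerDl.
by apply: sumr_ge0 => j _; rewrite -expr2 sqr_ge0.
Qed.

Lemma coord_le_norm x i : `|x 0 i| <= `|x|.
Proof.
rewrite [leRHS]/Num.norm /= mx_normrE; apply/bigmax_geP; right => /=.
by exists (0, i).
Qed.

Lemma norm_le_coord x r : 0 <= r -> (forall i, `|x 0 i| <= r) -> `|x| <= r.
Proof.
move=> r0 h; rewrite [leLHS]/Num.norm /= mx_normrE.
by apply/bigmax_leP; split => // -[i j] _ /=; rewrite (ord1 i).
Qed.

Lemma norm_le_enorm x : `|x| <= enorm x.
Proof. by apply: norm_le_coord => // i; exact: coord_le_enorm. Qed.

Lemma enorm_le_norm x : enorm x <= n%:R * `|x|.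
Proof.
apply: le_of_sqr; first exact: mulr_ge0.
rewrite sqr_enorm (@le_trans _ _ (\sum_(i < n) `|x| ^+ 2))//.
  apply: ler_sum => i _; rewrite -expr2 -real_normK ?num_real//.
  by rewrite ler_pXn2r ?nnegrE// coord_le_norm.
rewrite sumr_const card_ord exprMn -[leLHS]mulr_natl ler_wpM2r ?sqr_ge0//.
by rewrite -natrX ler_nat; case: (n) => // m; rewrite leq_pmulr.
Qed.

Lemma nbhs_enormP x (P : set 'rV[R]_n) :
  (\forall y \near x, P y) <->
  exists2 e, 0 < e & forall y, enorm (y - x) < e -> P y.
Proof.
split=> [/nbhs_ballP[e /= e0 h]|[e e0 h]].
  exists e => // y yx; apply: h; rewrite -ball_normE /=.
  by rewrite (le_lt_trans (norm_le_enorm _))// enormB.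
apply/nbhs_ballP; exists (e / n.+1%:R); first by rewrite /= divr_gt0.
move=> y; rewrite -ball_normE /= => yx; apply: h.
rewrite enormB (le_lt_trans (enorm_le_norm _))//.
rewrite ltr_pdivlMr// in yx.
apply: le_lt_trans yx; rewrite mulrC ler_wpM2l// ler_nat; exact: leqnSn.
Qed.

Lemma closure_enormP x (A : set 'rV[R]_n) :
  closure A x <-> forall e, 0 < e -> exists2 y, A y & enorm (y - x) < e.
Proof.
split=> [h e e0|h B /nbhs_enormP[e e0 hB]].
  have [] := h [set y | enorm (y - x) < e]; last by move=> y [? ?]; exists y.
  by apply/nbhs_enormP; exists e.
by have [y Ay yx] := h e e0; exists y; split => //; exact: hB.
Qed.

Lemma open_enormP (A : set 'rV[R]_n) :
  open A <-> forall x, A x ->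
    exists2 e, 0 < e & forall y, enorm (y - x) < e -> A y.
Proof.
rewrite openE; split=> h x Ax; apply/nbhs_enormP; exact: h.
Qed.

Lemma continuous_enormP (f : 'rV[R]_n -> R) x :
  {for x, continuous f} <-> forall e, 0 < e ->
    exists2 d, 0 < d & forall y, enorm (y - x) < d -> `|f y - f x| <= e.
Proof.
split=> [h e e0|h].
  have /nbhs_enormP[d d0 hd] : \forall y \near x, `|f x - f y| <= e.
    by move/cvgrPdist_le: h => /(_ e e0).
  by exists d => // y /hd; rewrite distrC.
apply/(@cvgrPdist_le _ _ _ (nbhs x)) => e e0; have [d d0 hd] := h e e0.
by apply/nbhs_enormP; exists d => // y /hd; rewrite distrC.
Qed.

Lemma lipschitz_continuous (f : 'rV[R]_n -> R) a :
  (forall x y, `|f x - f y| <= a * enorm (x - y)) -> continuous f.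
Proof.
move=> h x; apply/continuous_enormP => e e0.
have a0 : 0 < `|a| + 1 by rewrite ltr_wpDl.
exists (e / (`|a| + 1)); first exact: divr_gt0.
move=> y yx; apply: le_trans (h _ _) _.
rewrite ltr_pdivlMr// in yx; apply: le_trans (ltW yx).
rewrite mulrC ler_wpM2l//; have := ler_norm a; lra.
Qed.

Lemma continuous_dotp v : continuous (dotp v).
Proof.
apply: (@lipschitz_continuous _ (enorm v)) => x y.
by rewrite -dotpBr norm_dotp_le.
Qed.

Lemma continuous_enorm x : continuous (fun y => enorm (y - x)).
Proof.
apply: (@lipschitz_continuous _ 1) => y z; rewrite mul1r.
have := enorm_dist_triangle z y x; have := enorm_dist_triangle y z x.
rewrite (enormB z y) ler_norml; lra.
Qed.

End euclidean_space.
#[local] Hint Extern 0 (is_true (0 <= enorm _)) => exact: enorm_ge0 : core.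

(** * The operator on rank one matrices and on multiples *)

(** Both sides come from the determinant of the block matrix with blocks x, p,
    q, 1, computed by two different eliminations. *)
Lemma det_scalar_sub_rank1 (K : comNzRingType) m (x : K)
    (p : 'cV[K]_m) (q : 'rV[K]_m) :
  \det (x%:M - p *m q) * x = x ^+ m * (x - (q *m p) 0 0).
Proof.
pose M := block_mx (x%:M : 'M[K]_m) p q (1%:M : 'M[K]_1).
have E1 : M *m block_mx 1%:M (- p) 0 (x%:M)
    = block_mx x%:M 0 q (x%:M - q *m p).
  rewrite mulmx_block !mulmx1 !mulmx0 !addr0 !mul1mx mulmxN mulmxN.
  by rewrite mul_scalar_mx mul_mx_scalar addNr addrC.
have E2 : M *m block_mx 1%:M 0 (- q) 1%:M = block_mx (x%:M - p *m q) p 0 1%:M.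
  by rewrite mulmx_block !mulmx1 !mulmx0 !add0r mul1mx mulmxN addrN.
move: (congr1 determinant E1) (congr1 determinant E2).
rewrite !det_mulmx !det_ublock !det_lblock !det1 !det_scalar !expr1 !mul1r.
rewrite !mulr1 => + <- => ->; congr (_ * _).
by rewrite det_mx11 !mxE eqxx mulr1n.
Qed.

Section spectrum.
Context {R : realType}.

Lemma eigenvalsE n (X : 'M[R]_n) (l : n.-tuple R) :
  sorted <=%R l -> char_poly X = \prod_(z <- l) ('X - z%:P) ->
  eigenvals X = l.
Proof.
move=> sl El; rewrite /eigenvals; case: xgetP => [l' _ [sl' El']|]; last first.
  by move=> /(_ l) /not_andP[] //.
apply/val_inj/(sorted_eq le_trans le_anti sl' sl).
by apply: prod_XsubC_eq; rewrite -El -El'.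
Qed.

Lemma char_poly_rank1 n (c : R) (v : 'rV[R]_n.+1) :
  char_poly (c *: (v^T *m v)) = 'X^n * ('X - (c * dotp v v)%:P).
Proof.
apply: (mulIf (x := 'X)); first by rewrite polyX_eq0.
rewrite /char_poly /char_poly_mx scalemxAl map_mxM det_scalar_sub_rank1 exprS.
rewrite -map_mxM -scalemxAr [in LHS]mxE [in LHS]mxE -mulrA [LHS]mulrC.
congr (_ * ('X - (_ * _)%:P) * _); rewrite mxE; apply: eq_bigr => i _.
by rewrite mxE.
Qed.

Lemma prod_nseq0 n : \prod_(z <- nseq n 0) ('X - z%:P) = 'X^n :> {poly R}.
Proof. by rewrite big_nseq subr0 iter_mulr_1. Qed.

(** The spectrum of c v^T v consists of c and zeros, so the sign of c decides
    whether c is the last eigenvalue or the first one. *)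
Lemma Mop_rank1_ge0 n (a : 'I_n.+1 -> R) (c : R) (v : 'rV[R]_n.+1) :
  0 <= c -> enorm v = 1 -> Mop a (c *: (v^T *m v)) = a ord_max * c.
Proof.
move=> c0 v1; have vv : dotp v v = 1 by rewrite -sqr_enorm v1 expr1n.
have sz : size (rcons (nseq n 0) c) == n.+1 by rewrite size_rcons size_nseq.
rewrite /Mop (@eigenvalsE _ _ (Tuple sz)).
- rewrite big_ord_recr/= big1 ?add0r => [|i _].
    by rewrite (tnth_nth 0)/= nth_rcons size_nseq ltnn eqxx.
  by rewrite (tnth_nth 0)/= nth_rcons size_nseq ltn_ord nth_nseq ltn_ord mulr0.
- rewrite /=; case: (n) => //= m.
  by elim: m => [|m IH] /=; rewrite ?lexx ?c0.
- by rewrite char_poly_rank1 vv mulr1 /= -cats1 big_cat/= prod_nseq0 big_seq1.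
Qed.

Lemma Mop_rank1_le0 n (a : 'I_n.+1 -> R) (c : R) (v : 'rV[R]_n.+1) :
  c <= 0 -> enorm v = 1 -> Mop a (c *: (v^T *m v)) = a ord0 * c.
Proof.
move=> c0 v1; have vv : dotp v v = 1 by rewrite -sqr_enorm v1 expr1n.
have sz : size (c :: nseq n 0) == n.+1 by rewrite /= size_nseq.
rewrite /Mop (@eigenvalsE _ _ (Tuple sz)).
- rewrite big_ord_recl/= big1 ?addr0// => i _.
  by rewrite (tnth_nth 0)/= nth_nseq ltn_ord mulr0.
- rewrite /=; case: (n) => //= m; rewrite c0/=.
  by elim: m => //= m ->; rewrite lexx.
- by rewrite char_poly_rank1 vv mulr1 /= big_cons prod_nseq0 mulrC.
Qed.

(** Substituting c X for X compares the two polynomials and is injective. *)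
Lemma char_poly_scale n (X : 'M[R]_n) (c : R) (l : n.-tuple R) : c != 0 ->
  char_poly X = \prod_(z <- l) ('X - z%:P) ->
  char_poly (c *: X) = \prod_(z <- map ( *%R c) l) ('X - z%:P).
Proof.
move=> c0 El.
have polyK (p : {poly R}) : (p \Po (c *: 'X)) \Po (c^-1 *: 'X) = p.
  by rewrite -comp_polyA comp_polyZ comp_polyX scalerA divff// scale1r comp_polyXr.
rewrite -[LHS]polyK -[RHS]polyK; congr (_ \Po _).
transitivity (c%:P ^+ n * char_poly X).
  rewrite /char_poly -detZ /= -[_ \Po _]/(comp_poly _ _) -det_map_mx.
  congr (\det _); apply/matrixP => i j; rewrite !mxE/=.
  rewrite comp_polyB comp_polyC raddfMn/= comp_polyX mulrBr polyCM.
  by rewrite mulrnAr !mul_polyC.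
have -> : c%:P ^+ n = \prod_(i < n) c%:P by rewrite prodr_const card_ord.
rewrite El big_map !big_tuple -big_split /= rmorph_prod /=.
have factorE i : ('X - (c * tnth l i)%:P) \Po (c *: 'X) =
    c%:P * ('X - (tnth l i)%:P).
  by rewrite comp_polyB comp_polyX comp_polyC polyCM mulrBr !mul_polyC.
by under [RHS]eq_bigr do rewrite factorE.
Qed.

(** When the characteristic polynomial of X splits, its roots are multiplied
    by c; when it does not, both spectra take the default value 0. *)
Lemma Mop_scale n (a : 'I_n -> R) (X : 'M[R]_n) (c : R) : 0 < c ->
  Mop a (c *: X) = c * Mop a X.
Proof.
move=> c0; have cn0 : c != 0 by rewrite gt_eqF.
have homo_sorted (k : R) (l : seq R) : 0 < k -> sorted <=%R l ->
    sorted <=%R (map ( *%R k) l).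
  move=> k0; rewrite sorted_map; apply: sub_sorted => x y /= xy.
  by rewrite ler_pM2l.
suff eigE : eigenvals (c *: X) = map_tuple ( *%R c) (eigenvals X).
  rewrite /Mop eigE mulr_sumr; apply: eq_bigr => i _; rewrite tnth_map; ring.
rewrite [in RHS]/eigenvals; case: xgetP => [l _ [sl El]|noX].
  by apply: eigenvalsE; [exact: homo_sorted | exact: char_poly_scale].
rewrite /eigenvals; case: xgetP => [l _ [sl El]|_].
  exfalso; apply: (noX (map_tuple ( *%R c^-1) l)); split => /=.
    by apply: homo_sorted => //; rewrite invr_gt0.
  by rewrite -[X](scalerK cn0); apply: char_poly_scale; rewrite ?invr_eq0.
by apply/val_inj; rewrite /= map_nseq mulr0.
Qed.

End spectrum.

(** * Comparison with quadratic polynomials *)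

Section comparison.
Context {R : realType} {n : nat}.
Implicit Types (u f : 'rV[R]_n.+1 -> R) (Omega : set 'rV[R]_n.+1).

(** The only consequence of the equation that the barriers need.  It is
    one-sided, so that stating it for u and for - u treats subsolutions and
    supersolutions, hence a_1 and a_n, alike. *)
Definition not_touched Omega u (c : R) :=
  forall x xi nu : 'rV[R]_n.+1, Omega x -> enorm nu = 1 ->
  ~ \forall y \near x,
      u y <= u x + dotp xi (y - x) - c * dotp nu (y - x) ^+ 2.

Lemma quadr_rank1 (x xi nu : 'rV[R]_n.+1) (k : R) (y : 'rV[R]_n.+1) :
  quadr x xi (k *: (nu^T *m nu)) y =
  dotp xi (y - x) + 2^-1 * (k * dotp nu (y - x) ^+ 2).
Proof.
rewrite /quadr -scalemxAr mulmxA dotpZl; congr (_ + _ * (_ * _)).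
have -> : (y - x) *m nu^T = (dotp nu (y - x))%:M.
  apply/matrixP => i j; rewrite !ord1 !mxE eqxx mulr1n /dotp.
  by apply: eq_bigr => k' _; rewrite !mxE mulrC.
by rewrite mul_scalar_mx dotpZl expr2.
Qed.

Lemma tr_rank1 (nu : 'rV[R]_n.+1) (k : R) :
  (k *: (nu^T *m nu))^T = k *: (nu^T *m nu).
Proof. by rewrite linearZ/= trmx_mul trmxK. Qed.

Lemma subsolution_not_touched (a : 'I_n.+1 -> R) Omega f u (F c : R) :
  viscosity_subsolution a Omega f u -> (forall x, Omega x -> `|f x| <= F) ->
  0 <= c -> F < 2 * c * a ord0 -> not_touched Omega u c.
Proof.
move=> [_ sub] fF c0 Fc x xi nu Ox nu1 touch.
have := sub x Ox xi ((- (2 * c)) *: (nu^T *m nu)) (tr_rank1 _ _).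
rewrite Mop_rank1_le0//; last by rewrite oppr_le0 mulr_ge0.
have := fF x Ox; rewrite ler_norml => /andP[f1 _].
have : superjet u x xi ((- (2 * c)) *: (nu^T *m nu)).
  move=> e e0; apply: filterS touch => y; rewrite quadr_rank1 => h.
  have : 0 <= e * enorm (y - x) ^+ 2 by rewrite mulr_ge0 ?sqr_ge0 ?(ltW e0).
  lra.
move=> J /(_ J); lra.
Qed.

Lemma supersolution_not_touched (a : 'I_n.+1 -> R) Omega f u (F c : R) :
  viscosity_supersolution a Omega f u -> (forall x, Omega x -> `|f x| <= F) ->
  0 <= c -> F < 2 * c * a ord_max -> not_touched Omega (\- u) c.
Proof.
move=> [_ super] fF c0 Fc x xi nu Ox nu1 touch.
have := super x Ox (- xi) ((2 * c) *: (nu^T *m nu)) (tr_rank1 _ _).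
rewrite Mop_rank1_ge0//; last by rewrite mulr_ge0.
have := fF x Ox; rewrite ler_norml => /andP[_ f1].
have : subjet u x (- xi) ((2 * c) *: (nu^T *m nu)).
  move=> e e0; apply: filterS touch => y; rewrite quadr_rank1 dotpNl /= => h.
  have : 0 <= e * enorm (y - x) ^+ 2 by rewrite mulr_ge0 ?sqr_ge0 ?(ltW e0).
  lra.
move=> J /(_ J); lra.
Qed.

(** The comparison function is exactly a quadratic polynomial with a rank one
    Hessian, so it is its own test function at a maximum of the difference. *)
Lemma quadratic_comparison Omega u (c p : R) (q nu : 'rV[R]_n.+1) :
  open Omega -> compact (closure Omega) ->
  {within closure Omega, continuous u} ->
  not_touched Omega u c -> enorm nu = 1 ->
  (forall x, boundary Omega x -> u x <= p + dotp q x - c * dotp nu x ^+ 2) ->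
  forall x, closure Omega x -> u x <= p + dotp q x - c * dotp nu x ^+ 2.
Proof.
move=> oO cO cu nt nu1 bu x Kx.
pose v y : R := p + dotp q y - c * dotp nu y ^+ 2.
have cv : continuous v.
  have cq := @continuous_dotp R n.+1.
  move=> y; apply: (@continuousB _ _ _ (cst p + dotp q)
      (fun z => c * dotp nu z ^+ 2)).
    by apply: continuousD; [exact: cst_continuous|exact: cq].
  apply: (@continuousM _ _ (cst c) (fun z => dotp nu z ^+ 2)).
    exact: cst_continuous.
  exact: (@continuousM _ _ (dotp nu) (dotp nu) _ (cq _ _) (cq _ _)).
have cw : {within closure Omega, continuous (fun y => u y - v y)}.
  by move=> y; apply: cvgB; [exact: cu|exact: (continuous_subspaceT cv)].
have K0 : closure Omega !=set0 by exists x.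
have [x0 /set_mem Kx0 maxx0] := compact_EVT_max K0 cO cw.
have := maxx0 _ (mem_set Kx); suff : u x0 - v x0 <= 0 by rewrite /v; lra.
have [Ox0|nOx0] := pselect (Omega x0); last first.
  rewrite subr_le0; apply: bu; split => // /interior_subset //.
exfalso; apply: (nt x0 (q - (2 * c * dotp nu x0) *: nu) nu Ox0 nu1).
have : \forall y \near x0, Omega y by exact: open_nbhs_nbhs.
apply: filterS => y Oy; have := maxx0 y (mem_set (subset_closure Oy)).
have -> : u x0 + dotp (q - (2 * c * dotp nu x0) *: nu) (y - x0) -
   c * dotp nu (y - x0) ^+ 2 = u x0 + (v y - v x0).
  by rewrite /v !dotpE; ring.
lra.
Qed.

End comparison.

(** * Barriers at a boundary point *)

Section barrier.
Context {R : realType} {n : nat}.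
Implicit Types (u : 'rV[R]_n.+1 -> R) (Omega : set 'rV[R]_n.+1).

(** The exterior sphere condition at y without its center y - rad nu: the
    closed ball is cut out by the inequality between the squared distance to
    y and the height over the tangent hyperplane at y. *)
Definition outer_normal (rad : R) Omega (y nu : 'rV[R]_n.+1) :=
  enorm nu = 1 /\ forall x, closure Omega x ->
    enorm (x - y) ^+ 2 <= 2 * rad * dotp nu (y - x).

Lemma outer_normalP (rad : R) Omega y : 0 < rad ->
  exterior_sphere rad Omega -> boundary Omega y ->
  exists nu, outer_normal rad Omega y nu.
Proof.
move=> r0 es /es[z [yz sub]]; exists (rad^-1 *: (y - z)); split.
  by rewrite enormZ yz gtr0_norm ?invr_gt0// mulVf// gt_eqF.
move=> x /sub; rewrite /closed_eball /= => xz.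
have : enorm (x - z) ^+ 2 <= rad ^+ 2.
  by rewrite ler_pXn2r ?nnegrE ?(ltW r0).
rewrite -[x - z](_ : (x - y) + (y - z) = _); last by rewrite addrA subrK.
rewrite sqr_enormD yz dotpZl -(opprB x y) dotpNr (dotpC (y - z)).
have -> : 2 * rad * (rad^-1 * - dotp (x - y) (y - z)) =
  (rad / rad) * (- 2 * dotp (x - y) (y - z)) by ring.
rewrite divff ?gt_eqF//; lra.
Qed.

Section height.
Context (rad : R) Omega (y nu : 'rV[R]_n.+1).
Hypotheses (r0 : 0 < rad) (onu : outer_normal rad Omega y nu).

Lemma height_ge0 x : closure Omega x -> 0 <= dotp nu (y - x).
Proof.
move=> /onu.2 h; have : 0 <= 2 * rad * dotp nu (y - x).
  exact: le_trans (sqr_ge0 _) h.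
by rewrite pmulr_rge0// mulr_gt0.
Qed.

Lemma height_le_dist x : dotp nu (y - x) <= enorm (x - y).
Proof.
by have := dotp_le_enorm nu (y - x); rewrite onu.1 mul1r enormB.
Qed.

Lemma dist_le_diam x : closure Omega x -> enorm (x - y) <= 2 * rad.
Proof.
move=> /onu.2 h; have hx := height_le_dist x.
rewrite leNgt; apply/negP => lt2.
have t0 : 0 < enorm (x - y) by apply: lt_trans lt2; rewrite mulr_gt0.
have : 2 * rad * dotp nu (y - x) < enorm (x - y) * enorm (x - y).
  apply: (@le_lt_trans _ _ (2 * rad * enorm (x - y))).
    by rewrite ler_wpM2l// mulr_ge0// ltW.
  by rewrite ltr_pM2r.
by rewrite -expr2 ltNge h.
Qed.

Lemma height_gt0 x : closure Omega x -> x != y -> 0 < dotp nu (y - x).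
Proof.
move=> /onu.2 h xy; have : 0 < 2 * rad * dotp nu (y - x).
  by apply: lt_le_trans h; rewrite exprn_gt0// enorm_gt0 subr_eq0.
by rewrite pmulr_rgt0// mulr_gt0.
Qed.

End height.

Lemma powR_split (x k : R) : 0 <= x -> 0 < k <= 1 -> x = x `^ k * x `^ (1 - k).
Proof.
move=> x0 /andP[k0 k1]; have [->|xn0] := eqVneq x 0.
  by rewrite (@powR0 _ k) ?mul0r// gt_eqF.
by rewrite -powRD ?xn0 ?implybT// addrC subrK powRr1.
Qed.

(** A substitute for the tangent line of the concave function s |-> s^k at s1:
    an affine majorant, off by a factor 2 at s1.  Compare s with s1. *)
Lemma powR_le_affine (s s1 k : R) : 0 <= s -> 0 < s1 -> 0 < k <= 1 ->
  s `^ k <= s1 `^ k + s1 `^ (k - 1) * s.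
Proof.
move=> s0 s10 /[dup] k01 /andP[k0 k1]; have [ss1|s1s] := leP s s1.
  rewrite ler_wpDr//; first by rewrite mulr_ge0// powR_ge0.
  by rewrite ge0_ler_powR ?nnegrE// ltW.
rewrite ler_wpDl ?powR_ge0//.
rewrite -(@mulr_powRB1 _ s)// mulrC ler_wpM2r// -opprB !powRN lef_pV2 ?posrE ?powR_gt0//; last first.
  exact: lt_trans s1s.
by rewrite ge0_ler_powR ?nnegrE ?subr_ge0// ltW.
Qed.

(** Near a boundary point the graph of u is trapped by barriers that depend on
    one variable only, the height over the tangent hyperplane.  For each point
    the power barrier is replaced by the quadratic polynomial in the height
    that dominates it on the boundary and is comparable to it at that point. *)
Lemma upper_barrier (rad k K c p : R) Omega u (y nu q : 'rV[R]_n.+1) :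
  0 < rad -> 0 < k <= 1 -> 0 <= K -> 0 <= c -> open Omega ->
  compact (closure Omega) -> {within closure Omega, continuous u} ->
  not_touched Omega u c -> outer_normal rad Omega y nu -> boundary Omega y ->
  (forall x, boundary Omega x ->
    u x <= p + dotp q x + K * dotp nu (y - x) `^ k) ->
  forall x, closure Omega x ->
    u x <= p + dotp q x +
           (2 * K + c * (2 * rad * (2 * rad) `^ (1 - k))) * dotp nu (y - x) `^ k.
Proof.
move=> r0 k01 K0 c0 oO cO cu nt onu yB ub x Kx.
pose D := 2 * rad * (2 * rad) `^ (1 - k).
have D0 : 0 <= D by rewrite mulr_ge0 ?powR_ge0 ?mulr_ge0// ltW.
have cD0 : 0 <= c * D by rewrite mulr_ge0.
have [Ox|nOx] := pselect (Omega x); last first.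
  apply: le_trans (ub x _) _; first by split => // /interior_subset.
  rewrite lerD2l ler_wpM2r ?powR_ge0// -/D; lra.
have xy : x != y.
  apply/eqP => xy; case: yB => _; apply; rewrite -xy.
  by move: oO; rewrite openE; apply.
pose s1 := dotp nu (y - x).
have s10 : 0 < s1 := height_gt0 r0 onu Kx xy.
pose b := dotp nu y.
have := @quadratic_comparison _ _ Omega u c
  (p + K * (s1 `^ k + s1 `^ (k - 1) * b) + c * (b * (2 * rad - b)))
  (q + (- (K * s1 `^ (k - 1)) + c * (2 * b - 2 * rad)) *: nu) nu
  oO cO cu nt onu.1.
have E z : p + K * (s1 `^ k + s1 `^ (k - 1) * b) + c * (b * (2 * rad - b)) +
   dotp (q + (- (K * s1 `^ (k - 1)) + c * (2 * b - 2 * rad)) *: nu) z -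
   c * dotp nu z ^+ 2 = p + dotp q z +
   K * (s1 `^ k + s1 `^ (k - 1) * dotp nu (y - z)) +
   c * (dotp nu (y - z) * (2 * rad - dotp nu (y - z))).
  by rewrite !dotpE /b; ring.
move=> cmp; apply: le_trans (cmp _ _ Kx) _; last first.
  rewrite E -/s1 -addrA lerD2l -/D.
  have -> : s1 `^ (k - 1) * s1 = s1 `^ k.
    by rewrite mulrC mulr_powRB1// ?ltW//; case/andP: k01.
  suff /(ler_wpM2l c0) : s1 * (2 * rad - s1) <= D * s1 `^ k by lra.
  apply: (@le_trans _ _ (s1 * (2 * rad))).
    by rewrite ler_wpM2l ?(ltW s10)//; lra.
  rewrite mulrC /D -mulrA ler_wpM2l//; first by lra.
  rewrite [leLHS](powR_split (ltW s10) k01) mulrC ler_wpM2r ?powR_ge0//.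
  have s1r : s1 <= 2 * rad.
    exact: le_trans (height_le_dist onu x) (dist_le_diam r0 onu Kx).
  rewrite ge0_ler_powR ?nnegrE// ?(ltW s10)//; last by lra.
  by case/andP: k01 => _ ?; rewrite subr_ge0.
move=> z zB; have Kz := zB.1; rewrite E.
have h0 := height_ge0 r0 onu Kz.
have hr := le_trans (height_le_dist onu z) (dist_le_diam r0 onu Kz).
apply: le_trans (ub z zB) _; rewrite -[leRHS]addrA lerD2l.
rewrite ler_wpDr//; first by rewrite mulr_ge0// mulr_ge0// subr_ge0.
by rewrite ler_wpM2l// powR_le_affine.
Qed.

(** The comparison requires c > c0; the bound passes to the limit c = c0, which
    keeps it homogeneous in the data, even when f = 0. *)
Lemma two_sided_barrier (rad k K c0 p : R) Omega u (y nu q : 'rV[R]_n.+1) :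
  0 < rad -> 0 < k <= 1 -> 0 <= K -> 0 <= c0 -> open Omega ->
  compact (closure Omega) -> {within closure Omega, continuous u} ->
  (forall c, c0 < c -> not_touched Omega u c /\ not_touched Omega (\- u) c) ->
  outer_normal rad Omega y nu -> boundary Omega y ->
  (forall x, boundary Omega x ->
    `|u x - (p + dotp q x)| <= K * dotp nu (y - x) `^ k) ->
  forall x, closure Omega x ->
    `|u x - (p + dotp q x)| <=
    (2 * K + c0 * (2 * rad * (2 * rad) `^ (1 - k))) * dotp nu (y - x) `^ k.
Proof.
move=> r0 k01 K0 c00 oO cO cu nt onu yB ub x Kx.
set D := 2 * rad * _; set P := _ `^ k.
have DP0 : 0 <= D * P.
  by rewrite !mulr_ge0 ?powR_ge0// ltW.
suff H c : c0 < c -> `|u x - (p + dotp q x)| <= (2 * K + c * D) * P.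
  apply/ler_addgt0Pr => e e0; have DP1 : 0 < D * P + 1 by rewrite ltr_wpDl.
  apply: le_trans (H (c0 + e / (D * P + 1)) _) _.
    by rewrite ltrDl divr_gt0.
  have -> : (2 * K + (c0 + e / (D * P + 1)) * D) * P =
    (2 * K + c0 * D) * P + e / (D * P + 1) * (D * P) by ring.
  by rewrite lerD2l mulrAC ler_pdivrMr// ler_wpM2l ?(ltW e0)// lerDl.
move=> /[dup] cc0 /nt[nt1 nt2]; have c_ge0 : 0 <= c := le_trans c00 (ltW cc0).
rewrite ler_norml; apply/andP; split.
  have := @upper_barrier rad k K c (- p) Omega (\- u) y nu (- q)
    r0 k01 K0 c_ge0 oO cO.
  move=> /(_ _ nt2 onu yB _ x Kx) H.
  rewrite -/D -/P dotpNl in H.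
  have {}H : - u x <= - p - dotp q x + (2 * K + c * D) * P.
    apply: H; first by move=> z; apply: cvgN; exact: cu.
    move=> z zB; rewrite dotpNl /=; have := ub z zB.
    rewrite ler_norml => /andP[]; lra.
  lra.
have := @upper_barrier rad k K c p Omega u y nu q
  r0 k01 K0 c_ge0 oO cO cu nt1 onu yB _ x Kx.
rewrite -/D -/P => H.
have {}H : u x <= p + dotp q x + (2 * K + c * D) * P.
  apply: H => z zB; have := ub z zB.
  rewrite ler_norml => /andP[]; lra.
lra.
Qed.

End barrier.

(** * Convexity, nearest points and projection *)

Section geometry.
Context {R : realType} {n : nat}.
Implicit Types (Omega : set 'rV[R]_n.+1) (x y z p q w : 'rV[R]_n.+1).

Lemma boundaryP Omega x : open Omega ->
  boundary Omega x <-> closure Omega x /\ ~ Omega x.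
Proof.
rewrite openE => oO; split=> -[cx nx]; split=> // h; apply: nx.
  exact: oO.
exact: interior_subset.
Qed.

(** The exit point is the infimum of the parameters at which the segment is
    outside Omega. *)
Lemma boundary_on_segment Omega x p : open Omega -> Omega x -> ~ Omega p ->
  exists2 t, 0 < t <= 1 & boundary Omega (x + t *: (p - x)).
Proof.
move=> /[dup] oO /open_enormP oOe Ox nOp.
have px : 0 < enorm (p - x).
  by rewrite enorm_gt0 subr_eq0; apply: contra_notN nOp => /eqP ->.
have distE s t : enorm ((x + s *: (p - x)) - (x + t *: (p - x)))
    = `|s - t| * enorm (p - x).
  by rewrite opprD addrACA subrr add0r -scalerBl enormZ.
pose T := [set t : R | 0 <= t /\ ~ Omega (x + t *: (p - x))].
have T1 : T 1 by split => //; rewrite scale1r addrC subrK.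
have infT : has_inf T by split; [exists 1 | exists 0 => t []].
have t01 : inf T <= 1 by apply: ge_inf => //; exact: infT.2.
have t00 : 0 <= inf T by apply: lb_le_inf; [exists 1 | move=> t []].
have below t : 0 <= t -> t < inf T -> Omega (x + t *: (p - x)).
  move=> t0 tT; apply: contrapT => nO; move: tT; apply/negP; rewrite -leNgt.
  by apply: ge_inf => //; exact: infT.2.
have nOt : ~ Omega (x + inf T *: (p - x)).
  move=> /oOe[e e0 he]; pose d := e / enorm (p - x).
  have d0 : 0 < d by rewrite divr_gt0.
  have : inf T + d <= inf T; last by rewrite gerDl leNgt d0.
  apply: lb_le_inf; first by exists 1.
  move=> t [t0 nO]; rewrite leNgt; apply/negP => tlt; apply: nO.
  have [tT|Tt] := ltP t (inf T); first exact: below.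
  by apply: he; rewrite distE ger0_norm ?subr_ge0// -ltr_pdivlMr// ltrBlDl.
have tgt0 : 0 < inf T.
  rewrite lt_neqAle t00 andbT; apply: contra_notN nOt => /eqP <-.
  by rewrite scale0r addr0.
exists (inf T); first by rewrite tgt0.
apply/boundaryP => //; split => //; apply/closure_enormP => e e0.
pose d := Num.min (inf T) (e / (2 * enorm (p - x))).
have d0 : 0 < d by rewrite lt_min tgt0 divr_gt0// mulr_gt0.
exists (x + (inf T - d) *: (p - x)).
  apply: below; last by rewrite ltrBlDr ltrDl.
  by rewrite subr_ge0 ge_min lexx.
rewrite distE addrAC subrr add0r normrN gtr0_norm//.
apply: (@le_lt_trans _ _ (e / (2 * enorm (p - x)) * enorm (p - x))).
  by rewrite ler_pM2r// ge_min lexx orbT.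
rewrite invfM mulrA mulfVK ?gt_eqF//; lra.
Qed.

(** z is a point of the complement nearest to x.  It is on the boundary because
    the segment from x to z cannot leave Omega before z. *)
Lemma nearest_boundary_point Omega x p : open Omega -> Omega x -> ~ Omega p ->
  exists2 z, boundary Omega z & eball x (enorm (z - x)) `<=` Omega.
Proof.
move=> /[dup] oO /open_enormP oOe Ox nOp.
pose K := closed_eball x (enorm (p - x)) `&` ~` Omega.
have cx := @continuous_enorm R n.+1 x.
have cK : compact K.
  apply: bounded_closed_compact.
    exists (`|x| + enorm (p - x)); split; first by rewrite num_real.
    move=> r rlt y [yx _]; apply: le_trans (ltW rlt).
    rewrite -[y](subrK x) addrC (le_trans (ler_normD _ _))// lerD2l.
    exact: le_trans (norm_le_enorm _) yx.
  apply: closedI; last exact: open_closedC.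
  apply: (@closed_comp _ _ (fun y => enorm (y - x))
    [set r | r <= enorm (p - x)]); last exact: closed_le.
  by move=> y _; exact: cx.
have K0 : K !=set0 by exists p; split => //; rewrite /closed_eball /=.
have cKx : {within K, continuous (fun y => enorm (y - x))}.
  exact: continuous_subspaceT.
have [z /set_mem[_ nOz] minz'] := compact_EVT_min K0 cK cKx.
have minz y : K y -> enorm (z - x) <= enorm (y - x).
  by move=> /mem_set; exact: minz'.
have zp : enorm (z - x) <= enorm (p - x).
  by apply: minz; split => //; rewrite /closed_eball /=.
have sub : eball x (enorm (z - x)) `<=` Omega.
  move=> y yx; apply: contrapT => nOy.
  have : enorm (z - x) <= enorm (y - x).
    by apply: minz; split => //; exact/ltW/(lt_le_trans yx).
  by rewrite leNgt yx.
exists z => //; apply/boundaryP => //; split => //.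
have [t /andP[t0 t1] /(boundaryP _ oO)[bt nOt]] := boundary_on_segment oO Ox nOz.
suff -> : z = x + t *: (z - x) by [].
have [->|tn1] := eqVneq t 1; first by rewrite scale1r addrC subrK.
exfalso; apply: nOt; apply: sub; rewrite /eball /= addrC addKr enormZ gtr0_norm//.
rewrite gtr_pMl; first by rewrite lt_neqAle tn1.
rewrite enorm_gt0 subr_eq0.
by apply: contra_notN nOz => /eqP ->.
Qed.

Definition has_outer_normals (rad : R) Omega :=
  forall y, boundary Omega y -> exists nu, outer_normal rad Omega y nu.

(** At an exit point strictly between x and y, the height over the tangent
    hyperplane would be positive at both x and y and zero in between. *)
Lemma convex_of_outer_normals (rad : R) Omega x y (t : R) : 0 < rad ->
  open Omega -> has_outer_normals rad Omega -> Omega x -> Omega y ->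
  0 <= t <= 1 -> Omega (x + t *: (y - x)).
Proof.
move=> r0 oO on Ox Oy /andP[t0 t1]; apply: contrapT => nO.
have [s /andP[s0 s1]] := boundary_on_segment oO Ox nO.
rewrite [_ - x]addrC addKr scalerA; set k := s * t => bk.
have [nu onu] := on _ bk.
have [_ nb] := (boundaryP _ oO).1 bk.
have k1 : k < 1.
  rewrite lt_neqAle; apply/andP; split; last by rewrite mulr_ile1// ltW.
  apply: contra_notN nb => /eqP ->; by rewrite scale1r addrC subrK.
have k0 : 0 <= k by rewrite mulr_ge0// ltW.
have := height_gt0 r0 onu (subset_closure Ox) _.
have := height_gt0 r0 onu (subset_closure Oy) _.
have -> : x + k *: (y - x) - x = k *: (y - x) by rewrite addrC addKr.
have -> : x + k *: (y - x) - y = - (1 - k) *: (y - x).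
  by rewrite scaleNr scalerBl scale1r opprB addrAC -[x - y]opprB addrC.
rewrite !dotpZr => h1 h2.
have {}h1 : 0 < - (1 - k) * dotp nu (y - x).
  by apply: h1; apply: contra_notN nb => /eqP <-.
have {}h2 : 0 < k * dotp nu (y - x).
  by apply: h2; apply: contra_notN nb => /eqP <-.
have : 0 < dotp nu (y - x) by nra.
nra.
Qed.

Lemma closure_convex Omega x y (t : R) :
  (forall a b s, Omega a -> Omega b -> 0 <= s <= 1 ->
    Omega (a + s *: (b - a))) ->
  closure Omega x -> closure Omega y -> 0 <= t <= 1 ->
  closure Omega (x + t *: (y - x)).
Proof.
move=> cvx /closure_enormP cx /closure_enormP cy /[dup] t01 /andP[t0 t1].
apply/closure_enormP => e e0.
have e20 : 0 < e / 2 by rewrite divr_gt0.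
have [a Oa ax] := cx _ e20; have [b Ob yb] := cy _ e20.
exists (a + t *: (b - a)); first exact: cvx.
have -> : a + t *: (b - a) - (x + t *: (y - x)) =
  (1 - t) *: (a - x) + t *: (b - y).
  by apply/rowP => i; rewrite !mxE; ring.
apply: le_lt_trans (ler_enormD _ _) _; rewrite !enormZ !ger0_norm ?subr_ge0//.
apply: (@le_lt_trans _ _ ((1 - t) * (e / 2) + t * (e / 2))); last by lra.
by rewrite lerD// ler_wpM2l ?subr_ge0// ltW.
Qed.

(** Otherwise a small step from q towards w would get closer to p. *)
Lemma projection_variational (K : set 'rV[R]_n.+1) p q :
  (forall x y t, K x -> K y -> 0 <= t <= 1 -> K (x + t *: (y - x))) ->
  K q -> (forall w, K w -> enorm (q - p) <= enorm (w - p)) ->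
  forall w, K w -> dotp (p - q) (w - q) <= 0.
Proof.
move=> cvx Kq minq w Kw; rewrite leNgt; apply/negP => s0.
set s := dotp (p - q) (w - q) in s0 *; pose W := enorm (w - q) ^+ 2.
have W0 : 0 <= W by rewrite sqr_ge0.
pose t := s / (s + W); have sW : 0 < s + W by rewrite ltr_pwDl.
have t0 : 0 < t by rewrite divr_gt0.
have t1 : t <= 1 by rewrite ler_pdivrMr// mul1r lerDl.
have := minq _ (cvx _ _ t Kq Kw _); rewrite (ltW t0) t1 => /(_ erefl).
have -> : q + t *: (w - q) - p = t *: (w - q) - (p - q).
  by apply/rowP => i; rewrite !mxE; ring.
rewrite (enormB q) -ler_sqr ?nnegrE// (sqr_enormB (t *: _)) enormZ dotpZl.
rewrite (dotpC (w - q)) -/s gtr0_norm// exprMn -/W => h.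
have {}h : 2 * s <= t * W by nra.
have : t * W <= s.
  by rewrite /t mulrAC ler_pdivrMr// ler_wpM2l ?lerDr ?(ltW s0).
lra.
Qed.

(** Projecting on the closure is a contraction that takes the complement of
    Omega to its boundary, so that a short path around Omega yields a short
    path on its boundary. *)
Lemma boundary_projection (rad : R) Omega : 0 < rad -> open Omega ->
  Omega !=set0 -> compact (closure Omega) -> has_outer_normals rad Omega ->
  exists P : 'rV[R]_n.+1 -> 'rV[R]_n.+1,
    [/\ forall p, closure Omega p -> P p = p,
        forall p, ~ Omega p -> boundary Omega (P p) &
        forall p q, enorm (P p - P q) <= enorm (p - q)].
Proof.
move=> r0 oO [x0 Ox0] cO on.
have cvx x y t : closure Omega x -> closure Omega y -> 0 <= t <= 1 ->
    closure Omega (x + t *: (y - x)).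
  by apply: closure_convex => *; exact: (convex_of_outer_normals r0 oO on).
have /choice[P HP] p : exists q, closure Omega q /\
    forall w, closure Omega w -> enorm (q - p) <= enorm (w - p).
  have K0 : closure Omega !=set0 by exists x0; exact: subset_closure.
  have cKx : {within closure Omega, continuous (fun y => enorm (y - p))}.
    by apply: continuous_subspaceT; exact: continuous_enorm.
  have [z /set_mem Kz minz] := compact_EVT_min K0 cO cKx.
  by exists z; split => // w Kw; apply: minz; exact: mem_set.
have var p w : closure Omega w -> dotp (p - P p) (w - P p) <= 0.
  exact: (projection_variational cvx (HP p).1 (HP p).2).
have fixP p : closure Omega p -> P p = p.
  move=> /(HP p).2; rewrite subrr enorm0 => h; apply/eqP.
  by rewrite -subr_eq0 -enorm_eq0 eq_le h enorm_ge0.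
exists P; split => //.
- move=> p nOp; apply/boundaryP => //; split; first exact: (HP p).1.
  move=> OP; have nP : P p != p by apply: contra_notN nOp => /eqP <-.
  have pP : 0 < enorm (p - P p) by rewrite enorm_gt0 subr_eq0 eq_sym.
  have [e e0 he] := (open_enormP _).1 oO _ OP.
  pose t := e / (2 * enorm (p - P p)).
  have t0 : 0 < t by rewrite divr_gt0// mulr_gt0.
  have := var p (P p + t *: (p - P p)).
  rewrite [_ + _ - P p]addrC addKr dotpZr -sqr_enorm.
  apply/not_implyP; split; last first.
    by apply/negP; rewrite -ltNge mulr_gt0// exprn_gt0.
  apply: subset_closure; apply: he; rewrite [_ + _ - P p]addrC addKr enormZ.
  by rewrite gtr0_norm// /t invfM mulrA mulfVK ?gt_eqF//; lra.
- move=> p q; have := var p (P q) (HP q).1; have := var q (P p) (HP p).1.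
  have [->|PN] := eqVneq (P p) (P q); first by rewrite subrr enorm0.
  have P0 : 0 < enorm (P p - P q) by rewrite enorm_gt0 subr_eq0.
  move=> h1 h2; rewrite -(ler_pM2r P0) -expr2.
  apply: le_trans (dotp_le_enorm (p - q) (P p - P q)).
  rewrite sqr_enorm; move: h1 h2; rewrite -[P q - P p]opprB !dotpE; lra.
Qed.

(** Suprema over pairs of distinct points of an empty family are -oo, so the
    Hölder seminorms on the boundary are nonnegative only thanks to this. *)
Lemma boundary_two_points Omega : open Omega -> Omega !=set0 ->
  bounded_set Omega -> exists x y, [/\ boundary Omega x, boundary Omega y & x != y].
Proof.
move=> oO [x Ox] [M [_ bO]].
pose e : 'rV[R]_n.+1 := delta_mx 0 0.
have far (s : R) : s \in [:: 1; -1] ->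
    ~ Omega (x + (s * (`|M| + 1 + `|x| + 1)) *: e).
  move=> s1 /(bO (`|M| + 1)).
  have -> : M < `|M| + 1 by rewrite (le_lt_trans (ler_norm _))// ltrDl.
  move=> /(_ isT); apply/negP; rewrite -ltNge.
  have := coord_le_norm (x + (s * (`|M| + 1 + `|x| + 1)) *: e) 0.
  apply: lt_le_trans; rewrite !mxE !eqxx mulr1.
  have sn : `|s| = 1 by move: s1; rewrite !inE => /orP[]/eqP->; rewrite ?normrN normr1.
  have -> : x 0 0 + s * (`|M| + 1 + `|x| + 1) =
     s * (`|M| + 1 + `|x| + 1) - (- x 0 0) by ring.
  apply: lt_le_trans (lerB_dist _ _); rewrite normrN normrM sn mul1r.
  have := coord_le_norm x 0; rewrite ger0_norm ?addr_ge0//; lra.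
have [|t /andP[t0 _] bt] := boundary_on_segment oO Ox (far 1 _).
  by rewrite !inE eqxx.
have [|s /andP[s0 _] bs] := boundary_on_segment oO Ox (far (-1) _).
  by rewrite !inE eqxx orbT.
exists (x + t *: (x + (1 * (`|M| + 1 + `|x| + 1)) *: e - x)).
exists (x + s *: (x + (-1 * (`|M| + 1 + `|x| + 1)) *: e - x)); split => //.
apply/eqP => /rowP/(_ 0); rewrite !mxE !eqxx !mulr1.
have := normr_ge0 M; have := normr_ge0 x; set m := `|M|; set k := `|x|.
nra.
Qed.

End geometry.

(** * First order expansion of the boundary values *)

Section mean_value.
Context {R : realType}.

(** A mean value inequality for functions with slopes bounded at each point,
    differentiable or not: paths on the boundary obtained by projection are
    merely Lipschitz. *)
Lemma le_of_local_slope (F : R -> R) (K : R) :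
  (forall t e, 0 <= t <= 1 -> 0 < e -> exists2 d, 0 < d &
    forall s, 0 <= s <= 1 -> `|s - t| < d ->
      `|F s - F t| <= (K + e) * `|s - t|) ->
  F 1 - F 0 <= K.
Proof.
move=> loc; apply/ler_addgt0Pr => e e0.
pose S := [set t : R | 0 <= t <= 1 /\ F t - F 0 <= (K + e) * t].
have S0 : S 0 by split; rewrite ?lexx ?ler01// subrr mulr0.
have supS : has_sup S by split; [exists 0 | exists 1 => t [/andP[]]].
have c1 : sup S <= 1 by apply: ge_sup; [exists 0 | move=> t [/andP[]]].
have c0 : 0 <= sup S by apply: ub_le_sup => //; exact: supS.2.
have c01 : 0 <= sup S <= 1 by rewrite c0.
have [d d0 hd] := loc _ _ c01 e0.
have Sc : F (sup S) - F 0 <= (K + e) * sup S.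
  have [t [t01 Ft] tc] := sup_adherent d0 supS.
  have tS : t <= sup S by apply: ub_le_sup => //; exact: supS.2.
  have := hd t t01; rewrite distrC ger0_norm ?subr_ge0// => h.
  have := h _; rewrite ltrBlDr -ltrBlDl => /(_ tc).
  rewrite ler_norml => /andP[]; lra.
have [c_lt1|] := ltP (sup S) 1; last first.
  move=> ge1; have cE : sup S = 1 by lra.
  by move: Sc; rewrite cE mulr1; lra.
exfalso; pose t := Num.min 1 (sup S + d / 2).
have ct : sup S < t by rewrite lt_min c_lt1 ltrDl divr_gt0.
have t01 : 0 <= t <= 1 by rewrite (le_trans c0 (ltW ct)) ge_min lexx.
have td : t <= sup S + d / 2 by rewrite ge_min lexx orbT.
suff : t <= sup S by rewrite leNgt ct.
apply: ub_le_sup; first exact: supS.2.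
split => //; have := hd t t01; rewrite gtr0_norm ?subr_gt0// => h.
have {}h : `|F t - F (sup S)| <= (K + e) * (t - sup S) by apply: h; lra.
move: h; rewrite ler_norml => /andP[]; lra.
Qed.

Lemma norm_le_of_local_slope (F : R -> R) (K : R) :
  (forall t e, 0 <= t <= 1 -> 0 < e -> exists2 d, 0 < d &
    forall s, 0 <= s <= 1 -> `|s - t| < d ->
      `|F s - F t| <= (K + e) * `|s - t|) ->
  `|F 1 - F 0| <= K.
Proof.
move=> loc; rewrite ler_norml (le_of_local_slope loc) andbT lerNl.
have := @le_of_local_slope (\- F) K; rewrite opprB /= opprK addrC; apply.
move=> t e t01 e0; have [d d0 hd] := loc t e t01 e0; exists d => // s s01 st.
by rewrite -opprD normrN; exact: hd.
Qed.

End mean_value.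

Section taylor.
Context {R : realType} {n : nat}.
Implicit Types (Omega : set 'rV[R]_n.+1) (g : 'rV[R]_n.+1 -> R).

Lemma diff_grad g (q v : 'rV[R]_n.+1) : differentiable g q ->
  'd g q v = dotp (grad g q) v.
Proof.
move=> dg; rewrite [in LHS](row_sum_delta v) linear_sum; apply: eq_bigr => i _.
by rewrite linearZ /= /grad mxE deriveE// mulrC.
Qed.

Lemma grad_expansion g (q : 'rV[R]_n.+1) (e : R) : differentiable g q -> 0 < e ->
  exists2 d, 0 < d & forall w, enorm (w - q) < d ->
    `|g w - g q - dotp (grad g q) (w - q)| <= e * enorm (w - q).
Proof.
move=> dg e0; have := diff_locally dg.
move=> /eqaddoP/(_ _ e0)/nbhs_enormP[d d0 hd].
exists d => // w wq; have := hd (w - q); rewrite subr0 => /(_ wq).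
rewrite !fctE /shift /= subrK diff_grad// opprD addrA => h.
apply: le_trans h _; rewrite ler_pM2l//; exact: norm_le_enorm.
Qed.

Lemma orthogonal_unit (nu v : 'rV[R]_n.+1) : (0 < n)%N ->
  exists d, [/\ enorm d = 1, dotp d nu = 0 & 0 <= dotp d v].
Proof.
move=> n0; have : kermx nu^T != 0.
  rewrite -mxrank_eq0 mxrank_ker subn_eq0 -ltnNge.
  exact: leq_ltn_trans (rank_leq_col _) _.
case/rowV0Pn => w /sub_kermxP wnu w0.
have {}wnu : dotp w nu = 0.
  have := congr1 (fun A : 'M[R]_1 => A 0 0) wnu; rewrite !mxE => <-.
  by apply: eq_bigr => i _; rewrite mxE.
have ew : 0 < enorm w by rewrite enorm_gt0.
have [vw|vw] := leP 0 (dotp w v).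
  exists ((enorm w)^-1 *: w); rewrite enormZ !dotpZl wnu mulr0; split => //.
    by rewrite gtr0_norm ?invr_gt0// mulVf ?gt_eqF.
  by rewrite mulr_ge0// invr_ge0.
exists (- (enorm w)^-1 *: w); rewrite enormZ !dotpZl wnu mulr0; split => //.
  by rewrite normrN gtr0_norm ?invr_gt0// mulVf ?gt_eqF.
by rewrite mulNr -mulrN mulr_ge0 ?invr_ge0// oppr_ge0 ltW.
Qed.

Section boundary_expansion.
Context (rad beta N : R) Omega g.
Hypotheses (r0 : 0 < rad) (b0 : 0 <= beta) (b1 : beta < 1) (N0 : 0 <= N).
Hypotheses (oO : open Omega) (cO : compact (closure Omega))
  (O0 : Omega !=set0) (on : has_outer_normals rad Omega)
  (dg : forall p, boundary Omega p -> differentiable g p)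
  (gN : forall p, boundary Omega p -> `|g p| <= N)
  (gradN : forall p, boundary Omega p -> enorm (grad g p) <= N)
  (gradH : forall p q, boundary Omega p -> boundary Omega q ->
     enorm (grad g p - grad g q) <= N * enorm (p - q) `^ beta).

(** The segment projects to a path on the boundary that stays within r of y,
    where the gradient of g differs from its value at y by at most
    N r^beta. *)
Lemma linearization_error_segment (P : 'rV[R]_n.+1 -> 'rV[R]_n.+1)
    (y p p' : 'rV[R]_n.+1) (r : R) :
  (forall q, ~ Omega q -> boundary Omega (P q)) ->
  (forall q q', enorm (P q - P q') <= enorm (q - q')) ->
  boundary Omega y -> P y = y ->
  (forall t, 0 <= t <= 1 -> ~ Omega (p + t *: (p' - p))) ->
  enorm (p - y) <= r -> enorm (p' - y) <= r ->
  `|(g (P p') - dotp (grad g y) (P p')) - (g (P p) - dotp (grad g y) (P p))|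
  <= N * r `^ beta * enorm (p' - p).
Proof.
move=> bP lipP yB Py out pr p'r.
pose G q := g q - dotp (grad g y) q.
pose c (t : R) := p + t *: (p' - p).
set lam := enorm (p' - p); have lam0 : 0 <= lam := enorm_ge0 _.
have cE s t : enorm (P (c s) - P (c t)) <= `|s - t| * lam.
  apply: le_trans (lipP _ _) _; rewrite /c opprD addrACA subrr add0r.
  by rewrite -scalerBl enormZ.
have c1 : c 1 = p' by rewrite /c scale1r addrC subrK.
have c0 : c 0 = p by rewrite /c scale0r addr0.
suff : `|G (P (c 1)) - G (P (c 0))| <= N * r `^ beta * lam by rewrite c1 c0.
apply: (norm_le_of_local_slope (F := fun t => G (P (c t)))).
move=> t e t01 e0; have yt := bP _ (out _ t01).
have l1 : 0 < lam + 1 by rewrite ltr_wpDl.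
have el0 : 0 < e / (lam + 1) by rewrite divr_gt0.
have [d d0 hd] := grad_expansion (dg yt) el0.
have cr : enorm (P (c t) - y) <= r.
  rewrite -Py; apply: le_trans (lipP _ _) _.
  have -> : c t - y = (1 - t) *: (p - y) + t *: (p' - y).
    by apply/rowP => i; rewrite !mxE; ring.
  case/andP: t01 => t0 t1.
  apply: le_trans (ler_enormD _ _) _; rewrite !enormZ !ger0_norm ?subr_ge0//.
  apply: (@le_trans _ _ ((1 - t) * r + t * r)); last by lra.
  by rewrite lerD// ler_wpM2l ?subr_ge0.
have gr : enorm (grad g (P (c t)) - grad g y) <= N * r `^ beta.
  apply: le_trans (gradH yt yB) _; rewrite ler_wpM2l//.
  by rewrite ge0_ler_powR ?nnegrE// (le_trans _ cr).
exists (d / (lam + 1)); first by rewrite divr_gt0.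
move=> s s01 st; have cst := cE s t.
have close : enorm (P (c s) - P (c t)) < d.
  apply: le_lt_trans cst _; rewrite ltr_pdivlMr// in st.
  apply: le_lt_trans st; rewrite ler_wpM2l//; lra.
have := hd _ close; rewrite -/(c s) -/(c t).
set a := P (c s) in close cst *; set b := P (c t) in gr cst *.
move=> h.
have -> : G a - G b = (g a - g b - dotp (grad g b) (a - b)) +
    dotp (grad g b - grad g y) (a - b) by rewrite /G !dotpE; ring.
apply: le_trans (ler_normD _ _) _.
have M0 : 0 <= N * r `^ beta by rewrite mulr_ge0// powR_ge0.
have h2 : `|dotp (grad g b - grad g y) (a - b)| <=
    N * r `^ beta * enorm (a - b).
  by apply: le_trans (norm_dotp_le _ _) _; rewrite ler_wpM2r.
have h3 : (e / (lam + 1) + N * r `^ beta) * enorm (a - b) <=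
    (e / (lam + 1) + N * r `^ beta) * (`|s - t| * lam).
  by rewrite ler_wpM2l// addr_ge0// ltW.
have h4 : e / (lam + 1) * lam <= e.
  by rewrite mulrAC ler_pdivrMr// ler_wpM2l ?(ltW e0)//; lra.
have := ler_wpM2r (normr_ge0 (s - t)) h4.
lra.
Qed.

(** The two terms are for heights below and above rad / 8. *)
Definition expansion_cst : R :=
  28 * (2 * rad) `^ ((1 + beta) / 2) +
  (2 + 2 * rad) / (rad / 8) `^ ((1 + beta) / 2).

Lemma expansion_cst_ge0 : 0 <= expansion_cst.
Proof.
rewrite addr_ge0//; first by rewrite mulr_ge0// powR_ge0.
by rewrite divr_ge0 ?powR_ge0// addr_ge0// mulr_ge0// ltW.
Qed.

(** The remainder at x is controlled by the height h of x over the tangent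
    hyperplane at y, not just by the distance to y.  When h is small, x and y
    are joined by three segments that avoid Omega and have length of order
    T = sqrt (2 rad h): from x in a direction orthogonal to its normal, until
    the ball at y is left; then parallel to the normal of y, until the tangent
    hyperplane at y is crossed; then back to y beyond this hyperplane. *)
Lemma boundary_expansion (x y nu : 'rV[R]_n.+1) : (0 < n)%N ->
  boundary Omega x -> boundary Omega y -> outer_normal rad Omega y nu ->
  `|g x - (g y + dotp (grad g y) (x - y))| <=
  expansion_cst * N * dotp nu (y - x) `^ ((1 + beta) / 2).
Proof.
move=> n0 xB yB onu; have [cx nOx] := (boundaryP _ oO).1 xB.
set h := dotp nu (y - x); set k := (1 + beta) / 2.
have k0 : 0 < k by rewrite divr_gt0// ltr_wpDr.
have h0 : 0 <= h := height_ge0 r0 onu cx.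
have C1 : 0 <= 28 * (2 * rad) `^ k by rewrite mulr_ge0// powR_ge0.
have C2 : 0 <= (2 + 2 * rad) / (rad / 8) `^ k.
  by rewrite divr_ge0 ?powR_ge0// addr_ge0// mulr_ge0// ltW.
rewrite /expansion_cst -/k 2!mulrDl.
have [hbig|hsmall] := ltP (rad / 8) h.
  apply: (@le_trans _ _ ((2 + 2 * rad) * N)); last first.
    rewrite ler_wpDl ?mulr_ge0 ?powR_ge0//.
    have p8 : 0 < (rad / 8) `^ k by rewrite powR_gt0// divr_gt0.
    have -> : (2 + 2 * rad) / (rad / 8) `^ k * N * h `^ k =
       (2 + 2 * rad) * N * (h `^ k / (rad / 8) `^ k) by ring.
    rewrite ler_peMr//.
      by rewrite mulr_ge0// addr_ge0// mulr_ge0// ltW.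
    rewrite ler_pdivlMr// mul1r ge0_ler_powR ?nnegrE ?(ltW k0) ?(ltW hbig)//.
    by rewrite divr_ge0// ltW.
  rewrite opprD addrA; apply: le_trans (ler_normB _ _) _.
  have d1 : `|dotp (grad g y) (x - y)| <= N * (2 * rad).
    apply: le_trans (norm_dotp_le _ _) _.
    by rewrite ler_pM//; [exact: gradN|exact: (dist_le_diam r0 onu)].
  have d2 := le_trans (ler_normB _ _) (lerD (gN xB) (gN yB)).
  lra.
rewrite ler_wpDr//; first by rewrite (mulr_ge0 (mulr_ge0 C2 N0)) ?powR_ge0.
have [P [fixP bP lipP]] := boundary_projection r0 oO O0 cO on.
have [nux onux] := on xB.
pose z := y - rad *: nu.
have zE w : enorm (w - z) ^+ 2 =
    enorm (w - y) ^+ 2 - 2 * rad * dotp nu (y - w) + rad ^+ 2.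
  have -> : w - z = (w - y) + rad *: nu by rewrite /z opprB addrCA addrC.
  rewrite sqr_enormD enormZ onu.1 mulr1 dotpZr (dotpC (w - y)).
  by rewrite real_normK ?num_real// -(opprB y w) dotpNr enormN; ring.
have out_z w : rad ^+ 2 <= enorm (w - z) ^+ 2 -> ~ Omega w.
  move=> wz Ow; have [d d0 hd] := (open_enormP _).1 oO _ Ow.
  have wz0 : 0 < enorm (w - z).
    rewrite lt_neqAle enorm_ge0 andbT; apply: contraTneq wz => <-.
    by rewrite expr0n /= -ltNge exprn_gt0.
  pose t := d / (2 * enorm (w - z)).
  have t0 : 0 < t by rewrite divr_gt0// mulr_gt0.
  have /subset_closure /onu.2 : Omega (w + t *: (w - z)).
    apply: hd; rewrite [w + _]addrC addrK enormZ gtr0_norm//.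
    by rewrite /t invfM mulrA mulfVK ?gt_eqF//; lra.
  have := zE (w + t *: (w - z)).
  have -> : w + t *: (w - z) - z = (1 + t) *: (w - z).
    by rewrite scalerDl scale1r addrAC.
  rewrite enormZ exprMn real_normK ?num_real// => E1 E2.
  have : rad ^+ 2 < (1 + t) ^+ 2 * enorm (w - z) ^+ 2.
    apply: le_lt_trans wz _; rewrite ltr_pMl ?exprn_gt0//; nra.
  by rewrite E1; lra.
have out_y w : 0 <= dotp nu (w - y) -> ~ Omega w.
  move=> wy Ow; have wny : w != y.
    apply/eqP => wy'; have [_] := (boundaryP _ oO).1 yB; apply.
    by rewrite -wy'.
  have := height_gt0 r0 onu (subset_closure Ow) wny.
  rewrite -opprB dotpNr; lra.
have out_x w : 0 <= dotp nux (w - x) -> ~ Omega w.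
  move=> wx Ow; have wnx : w != x by apply/eqP => wx'; apply: nOx; rewrite -wx'.
  have := height_gt0 r0 onux (subset_closure Ow) wnx.
  rewrite -opprB dotpNr; lra.
have [d [d1 dnux dz]] := orthogonal_unit nux (x - z) n0.
pose T := Num.sqrt (2 * rad * h).
have rh0 : 0 <= 2 * rad * h by rewrite !mulr_ge0// ltW.
have T0 : 0 <= T by exact: sqrtr_ge0.
have T2 : T ^+ 2 = 2 * rad * h by rewrite sqr_sqrtr.
(* h <= rad / 8 gives T <= rad / 2 and h + T <= rad: q stays on the side of z
   where moving along nu increases the distance to z. *)
have hT : h <= T.
  apply: le_of_sqr => //; rewrite T2 expr2 ler_wpM2r//; lra.
have Tr : T <= rad / 2.
  apply: le_of_sqr; first by rewrite divr_ge0// ltW.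
  rewrite T2 expr2; have := ler_wpM2l (ltW r0) hsmall; lra.
have xyT : enorm (x - y) <= T.
  by apply: le_of_sqr => //; rewrite T2; exact: onu.2.
have dnu : - 1 <= dotp nu d <= 1.
  by have := norm_dotp_le nu d; rewrite onu.1 d1 mulr1 ler_norml.
pose q := x + T *: d; pose S := h + T; pose q' := q + S *: nu.
have S0 : 0 <= S by rewrite addr_ge0.
have qE : dotp nu (y - q) = h - T * dotp nu d.
  by rewrite /q opprD addrA dotpDr dotpNr dotpZr.
have qx : q - x = T *: d by rewrite /q addrC addKr.
have q'q : q' - q = S *: nu by rewrite /q' addrC addKr.
(* This segment lies in the tangent hyperplane at x. *)
have out1 t : 0 <= t <= 1 -> ~ Omega (x + t *: (q - x)).
  move=> _; apply: out_x.
  by rewrite qx [_ - x]addrC addKr !dotpZr (dotpC nux) dnux !mulr0.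
have nunu : dotp nu nu = 1 by rewrite -sqr_enorm onu.1 expr1n.
(* T is the length for which the segment certainly leaves the ball at y. *)
have qz : rad ^+ 2 <= enorm (q - z) ^+ 2.
  have -> : q - z = (x - z) + T *: d by rewrite /q addrAC.
  rewrite sqr_enormD zE enormZ d1 mulr1 real_normK ?num_real// T2 dotpZr -/h.
  have : 0 <= T * dotp (x - z) d by rewrite mulr_ge0// dotpC.
  have := sqr_ge0 (enorm (x - y)); lra.
have nuqz : 0 <= dotp nu (q - z).
  have -> : q - z = - (y - q) + rad *: nu.
    by rewrite /z; apply/rowP => i; rewrite !mxE; ring.
  rewrite dotpDr dotpNr dotpZr qE nunu mulr1; nra.
have out2 t : 0 <= t <= 1 -> ~ Omega (q + t *: (q' - q)).
  move=> /andP[t0 _]; apply: out_z.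
  have -> : q + t *: (q' - q) - z = (q - z) + (t * S) *: nu.
    by rewrite q'q scalerA addrAC.
  rewrite sqr_enormD dotpZr (dotpC _ nu).
  have : 0 <= t * S * dotp nu (q - z) by rewrite !mulr_ge0.
  have := sqr_ge0 (enorm ((t * S) *: nu)); lra.
have q'E : 0 <= dotp nu (q' - y).
  have -> : q' - y = - (y - q) + S *: nu.
    by rewrite /q'; apply/rowP => i; rewrite !mxE; ring.
  rewrite dotpDr dotpNr dotpZr qE nunu mulr1 /S; nra.
have out3 t : 0 <= t <= 1 -> ~ Omega (q' + t *: (y - q')).
  move=> /andP[_ t1]; apply: out_y.
  have -> : q' + t *: (y - q') - y = (1 - t) *: (q' - y).
    by apply/rowP => i; rewrite !mxE; ring.
  by rewrite dotpZr mulr_ge0// subr_ge0.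
have qy : enorm (q - y) <= 2 * T.
  have -> : q - y = (x - y) + T *: d by rewrite /q addrAC.
  apply: le_trans (ler_enormD _ _) _; rewrite enormZ d1 mulr1 ger0_norm//; lra.
have q'y : enorm (q' - y) <= 4 * T.
  have -> : q' - y = (q - y) + S *: nu by rewrite /q' addrAC.
  apply: le_trans (ler_enormD _ _) _; rewrite enormZ onu.1 mulr1 ger0_norm//.
  rewrite /S; lra.
have Py : P y = y by apply: fixP; exact: yB.1.
have Px : P x = x by apply: fixP.
have e1 := @linearization_error_segment P y x q (4 * T) bP lipP yB Py out1.
have e2 := @linearization_error_segment P y q q' (4 * T) bP lipP yB Py out2.
have e3 := @linearization_error_segment P y q' y (4 * T) bP lipP yB Py out3.
have {}e1 := e1 ltac:(lra) ltac:(lra).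
have {}e2 := e2 ltac:(lra) ltac:(lra).
have {}e3 := e3 ltac:(lra) ltac:(rewrite subrr enorm0; lra).
rewrite qx enormZ d1 mulr1 (ger0_norm T0) Px in e1.
rewrite q'q enormZ onu.1 mulr1 (ger0_norm S0) in e2.
rewrite Py enormB in e3.
set M := N * (4 * T) `^ beta in e1 e2 e3.
have M0 : 0 <= M by rewrite mulr_ge0// powR_ge0.
(* The three lengths are at most T, 2 T and 4 T. *)
have tot : `|g x - (g y + dotp (grad g y) (x - y))| <= M * (7 * T).
  have e2' : M * S <= M * (2 * T) by rewrite ler_wpM2l// /S; lra.
  have e3' := ler_wpM2l M0 q'y.
  move: e1; rewrite ler_norml => /andP[e1l e1u].
  move: e2; rewrite ler_norml => /andP[e2l e2u].
  move: e3; rewrite ler_norml => /andP[e3l e3u].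
  by rewrite ler_norml dotpBr; apply/andP; split; lra.
apply: le_trans tot _.
have MT : M * (7 * T) = (28 * N) * ((4 `^ beta / 4) * (T * T `^ beta)).
  by rewrite /M (powRM _ _ T0)//; field.
have TT : T * T `^ beta = (2 * rad) `^ k * h `^ k.
  have [T00|Tn0] := eqVneq T 0.
    have hE : h = 0.
      by apply/eqP; rewrite eq_le h0 andbT -T00.
    by rewrite T00 mul0r hE (@powR0 _ k) ?mulr0// gt_eqF.
  rewrite -powRM ?mulr_ge0 ?(ltW r0)// -T2 -powR_mulrn// -powRrM.
  rewrite -{1}[T]powRr1// -powRD ?Tn0 ?implybT//; congr (_ `^ _).
  by rewrite /k; field.
rewrite MT TT.
have b4 : 4 `^ beta / 4 <= 1 :> R.
  rewrite ler_pdivrMr// mul1r -[leRHS]powRr1//; apply: ler_powR; last exact: ltW.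
  by rewrite ler1n.
have -> : 28 * (2 * rad) `^ k * N * h `^ k =
   28 * N * (1 * ((2 * rad) `^ k * h `^ k)) by ring.
by rewrite ler_wpM2l ?mulr_ge0// ler_wpM2r// mulr_ge0// powR_ge0.
Qed.

End boundary_expansion.

End taylor.

(** * Lebesgue norms *)

Section norms.
Context {R : realType}.
Local Open Scope ereal_scope.

Definition tuple_box n (c : 'rV[R]_n) (r : R) : set (n.-tuple (measurableTypeR R)) :=
  [set t | forall i, `[(c ord0 i - r)%R, (c ord0 i + r)%R]%classic (tnth t i)].

Lemma measurable_tuple_box n (c : 'rV[R]_n) (r : R) :
  measurable (tuple_box c r).
Proof.
rewrite (_ : tuple_box c r = \bigcap_(i in [set: 'I_n]) ((@tnth n _)^~ i @^-1`
    `[(c ord0 i - r)%R, (c ord0 i + r)%R]%classic)).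
  apply: fin_bigcap_measurable => // i _.
  by rewrite -[X in measurable X]setTI; exact: measurable_tnth.
by apply/seteqP; split=> [t h i _|t h i]; exact: h.
Qed.

Lemma lebesgue_tuple_box_cube n (c : 'rV[R]_n) (r : R) : (0 <= r)%R ->
  lebesgue_tuple n (tuple_box c r) = ((2 * r) ^+ n)%:E.
Proof.
move=> r0; rewrite /tuple_box (@lebesgue_tuple_box R n
  (fun i => `[(c ord0 i - r)%R, (c ord0 i + r)%R]%classic)); last first.
  by move=> i; exact: measurable_itv.
under eq_bigr => i _.
  rewrite lebesgue_measure_itv /= lte_fin.
  rewrite (_ : (if _ then _ else _) = (2 * r)%:E).
  over.
  case: ifPn => [_|]; first by rewrite EFinN -EFinB; congr (_%:E); ring.
  by rewrite -leNgt => h; congr (_%:E); lra.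
by rewrite prodEFin prodr_const card_ord.
Qed.

(** The integral of a nonnegative function is a supremum over simple functions
    below it, hence monotone on arbitrary functions. *)
Lemma integral_le_cst_on d (T : measurableType d) (mu : {measure set T -> \bar R})
    (B : set T) (f : T -> \bar R) (k : R) : measurable B -> (0 <= k)%R ->
  (forall x, 0 <= f x) -> (forall x, B x -> f x <= k%:E) ->
  (forall x, ~ B x -> f x = 0) -> \int[mu]_x f x <= k%:E * mu B.
Proof.
move=> mB k0 f0 fB fnB; rewrite -integral_cst// [leRHS]integral_mkcond.
rewrite !ge0_integralTE//; last first.
  by move=> x; rewrite patchE; case: ifP => // _; rewrite lee_fin.
apply: ge_ereal_sup => _ [h /= hf <-]; apply: ereal_sup_ubound.
exists h => // x.
apply: le_trans (hf x) _; rewrite patchE; case: ifPn => [/set_mem/fB//|].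
by move=> nB; rewrite fnB//; move: nB; rewrite notin_setE.
Qed.

Section fixed_dimension.
Context {n : nat}.
Implicit Types (D : set 'rV[R]_n.+1) (h : 'rV[R]_n.+1 -> R).

Lemma abse_restrict_le D h (M : R) x : (0 <= M)%R ->
  (forall x, D x -> (`|h x| <= M)%R) -> `|((EFin \o h) \_ D) x| <= M%:E.
Proof.
move=> M0 hM; rewrite patchE; case: ifPn => [/set_mem /hM|_] /=.
  by rewrite lee_fin.
by rewrite normr0 lee_fin.
Qed.

Lemma Lnorm_on_pinfty_le D h (M : R) : (0 <= M)%R ->
  (forall x, D x -> (`|h x| <= M)%R) -> Lnorm_on +oo D h <= M%:E.
Proof.
move=> M0 hM; rewrite /Lnorm_on Lnorm.unlock; case: ifPn => _; last by rewrite lee_fin.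
by apply/ess_supP; apply: nearW => t /=; exact: abse_restrict_le.
Qed.

(** If |h| exceeded its essential supremum at a point of the open set D, it would
    do so on a cube, whose measure is positive. *)
Lemma Lnorm_on_pinfty_ge D h x : open D -> {within D, continuous h} -> D x ->
  (`|h x|)%:E <= Lnorm_on +oo D h.
Proof.
move=> oD ch Dx; rewrite leNgt; apply/negP => lt_h.
have L0 : 0 <= Lnorm_on +oo D h by exact: Lnorm_ge0.
set L := Lnorm_on _ _ _ in lt_h L0.
have Lfin : L \is a fin_num by rewrite ge0_fin_numE// (lt_trans lt_h)// ltry.
have cx : {for x, continuous h}.
  by move: ch; rewrite continuous_open_subspace// => /(_ x); apply; exact/mem_set.
have [d [d0 hd]] : exists d : R, (0 < d)%R /\
    forall y, (`|y - x| < d)%R -> D y /\ L < (`|h y|)%:E.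
  pose e := (`|h x| - fine L)%R.
  have e0 : (0 < e)%R by rewrite subr_gt0 -lte_fin fineK.
  have : \forall y \near x, D y /\ (`|h x - h y| < e)%R.
    apply: filterI; first exact: open_nbhs_nbhs.
    by move/cvgrPdist_lt : cx; apply.
  case/nbhs_ballP => d /= d0 hd; exists d; split => // y yx.
  have [|Dy hy] := hd y; first by rewrite -ball_normE /= distrC.
  split => //; rewrite -(fineK Lfin) lte_fin.
  have : (`|h x| <= `|h x - h y| + `|h y|)%R.
    by rewrite -[in leLHS](subrK (h y) (h x)) ler_normD.
  rewrite /e in hy; lra.
pose B := tuple_box x (d / 2).
have d20 : (0 < d / 2)%R by rewrite divr_gt0.
have mB : 0 < lebesgue_tuple n.+1 B.
  rewrite lebesgue_tuple_box_cube ?(ltW d20)// lte_fin exprn_gt0//; lra.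
have muT : 0 < lebesgue_tuple (R := R) n.+1 setT.
  apply: lt_le_trans mB _; apply: le_measure => //; rewrite inE//.
  exact: measurable_tuple_box.
have BD t : B t -> L < `|((EFin \o h) \_ D) (\row_i tnth t i)|.
  move=> Bt; have [|Dt Lt] := hd (\row_i tnth t i).
    apply: (@le_lt_trans _ _ (d / 2)%R); last by lra.
    apply: norm_le_coord; first exact: ltW.
    move=> i; rewrite !mxE ler_norml; have := Bt i.
    by rewrite /= in_itv /= => /andP[? ?]; apply/andP; split; lra.
  by rewrite patchE mem_set.
have := ess_sup_ge (lebesgue_tuple n.+1)
  (abse \o (fun t : n.+1.-tuple (measurableTypeR R) =>
     ((EFin \o h) \_ D) (\row_i tnth t i))).
have -> : ess_sup (lebesgue_tuple n.+1)
  (abse \o (fun t : n.+1.-tuple (measurableTypeR R) =>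
     ((EFin \o h) \_ D) (\row_i tnth t i))) = L.
  by rewrite /L /Lnorm_on Lnorm.unlock ifT.
move=> [N [mN N0 sN]].
have : lebesgue_tuple n.+1 B <= lebesgue_tuple n.+1 N.
  apply: le_measure; rewrite ?inE//; first exact: measurable_tuple_box.
  move=> t Bt; apply: sN => /=; apply/negP; rewrite -ltNge; exact: BD.
by rewrite N0 leNgt mB.
Qed.

(** The unit ball lies in a cube of side 2, whence the constant. *)
Lemma Lnorm_on_unit_ball_le h (M : R) : (0 <= M)%R ->
  (forall x, eball 0 1 x -> (`|h x| <= M)%R) ->
  Lnorm_on n.+1%:R%:E (eball 0 1) h <= (2 * M)%:E.
Proof.
move=> M0 hM; rewrite /Lnorm_on Lnorm.unlock.
pose f (t : n.+1.-tuple (measurableTypeR R)) :=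
  ((EFin \o h) \_ (eball (0 : 'rV[R]_n.+1) 1)) (\row_i tnth t i).
have p0 : (0 < n.+1%:R :> R)%R by [].
pose B := tuple_box (0 : 'rV[R]_n.+1) 1.
have I1 : \int[lebesgue_tuple n.+1]_t (`|f t| `^ n.+1%:R) <=
    (M `^ n.+1%:R)%:E * lebesgue_tuple n.+1 B.
  apply: integral_le_cst_on.
  - exact: measurable_tuple_box.
  - exact: powR_ge0.
  - by move=> t; exact: poweR_ge0.
  - move=> t _; rewrite -poweR_EFin.
    apply: gt0_ler_poweR; first exact: ltW.
    - by rewrite in_itv /= leey abse_ge0.
    - by rewrite in_itv /= leey lee_fin M0.
    - exact: abse_restrict_le.
  - move=> t nB; rewrite /f patchE ifN ?normr0 ?poweR0r ?abse0//.
      by rewrite poweR_EFin powR0// gt_eqF.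
    rewrite notin_setE => tb; apply: nB => i.
    rewrite /= in_itv /= !mxE sub0r add0r -ler_norml.
    have := coord_le_enorm (\row_i tnth t i) i; rewrite mxE => /le_trans; apply.
    by move: tb; rewrite /eball /= subr0 => /ltW.
rewrite lebesgue_tuple_box_cube// mulr1 -EFinM in I1.
apply: (@le_trans _ _ ((M `^ n.+1%:R * 2 ^+ n.+1)%:E `^ n.+1%:R^-1)).
  apply: gt0_ler_poweR => //.
  - by rewrite in_itv /= leey andbT; apply: integral_ge0 => t _; exact: poweR_ge0.
  - by rewrite in_itv /= leey andbT lee_fin mulr_ge0// powR_ge0.
rewrite poweR_EFin lee_fin -powR_mulrn// -powRM// -powRrM divff ?gt_eqF//.
by rewrite powRr1 ?mulr_ge0// mulrC.
Qed.

End fixed_dimension.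
End norms.

(** * Rescaled interior estimate *)

Section interior.
Context {R : realType} {n : nat}.
Implicit Types (u f : 'rV[R]_n.+1 -> R) (Omega : set 'rV[R]_n.+1).

Lemma open_eball (x : 'rV[R]_n.+1) (r : R) : open (eball x r).
Proof.
apply/open_enormP => y; rewrite /eball /= => yx.
exists (r - enorm (y - x)); first by rewrite subr_gt0.
by move=> z zy; have := enorm_dist_triangle y z x; lra.
Qed.

Section rescaling.
Context (x : 'rV[R]_n.+1) (d : R).
Hypothesis d0 : 0 < d.

Let zoom (p : 'rV[R]_n.+1) := x + d *: p.

Let zoomB p q : zoom p - zoom q = d *: (p - q).
Proof. by rewrite /zoom opprD addrACA subrr add0r -scalerBr. Qed.

Let zoomK y : zoom (d^-1 *: (y - x)) = y.
Proof. by rewrite /zoom scalerA divff ?gt_eqF// scale1r addrC subrK. Qed.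

Lemma zoom_eball Omega p : eball x d `<=` Omega -> eball 0 1 p -> Omega (zoom p).
Proof.
move=> sub; rewrite /eball /= subr0 => p1; apply: sub.
by rewrite /eball /= /zoom addrC addKr enormZ gtr0_norm// gtr_pMr.
Qed.

Lemma continuous_zoom u p (c k : R) : {for zoom p, continuous u} ->
  {for p, continuous (fun q => c * u (zoom q) - k)}.
Proof.
move=> /continuous_enormP cu; apply/continuous_enormP => e e0.
have c1 : 0 < `|c| + 1 by rewrite ltr_wpDl.
have [r r0 hr] := cu (e / (`|c| + 1)) (divr_gt0 e0 c1).
exists (r / d); first by rewrite divr_gt0.
move=> q qp; have {hr}/hr : enorm (zoom q - zoom p) < r.
  by rewrite zoomB enormZ gtr0_norm// mulrC -ltr_pdivlMr.
rewrite ler_pdivlMr// => h.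
rewrite opprB addrA subrK -mulrBr normrM.
apply: le_trans h; rewrite mulrC ler_wpM2l//; lra.
Qed.

Lemma quadr_zoom (p q xi : 'rV[R]_n.+1) (X : 'M[R]_n.+1) :
  quadr (zoom p) (d^-1 *: xi) (d^-1 ^+ 2 *: X) (zoom q) = quadr p xi X q.
Proof.
rewrite /quadr zoomB -scalemxAr -scalemxAl !dotpZl !dotpZr.
have dd : d^-1 * d = 1 by rewrite mulVf ?gt_eqF.
have -> : d^-1 * (d * dotp xi (q - p)) = (d^-1 * d) * dotp xi (q - p) by ring.
set Q := dotp ((q - p) *m X) (q - p).
have -> : d^-1 ^+ 2 * (d * (d * Q)) = (d^-1 * d) ^+ 2 * Q by ring.
by rewrite dd expr1n !mul1r.
Qed.

Lemma near_zoom p (P : set 'rV[R]_n.+1) :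
  (\forall q \near p, P q) -> \forall y \near zoom p, P (d^-1 *: (y - x)).
Proof.
case/nbhs_enormP => r r0 hr; apply/nbhs_enormP; exists (d * r).
  exact: mulr_gt0.
move=> y yp; apply: hr; rewrite -(@ltr_pM2l _ d)//.
by rewrite -{1}(gtr0_norm d0) -enormZ -zoomB zoomK.
Qed.

(** The operator is positively homogeneous of degree 1, so rescaling the
    variable by d only multiplies the right-hand side by d^2. *)
Lemma viscosity_solution_rescale (a : 'I_n.+1 -> R) Omega f u (k : R) :
  open Omega -> eball x d `<=` Omega -> viscosity_solution a Omega f u ->
  viscosity_solution a (eball 0 1) (fun p => d ^+ 2 * f (zoom p))
    (fun p => u (zoom p) - k).
Proof.
move=> oO sub [cu [_ subu] [_ supu]].
have cw p : eball 0 1 p -> {for p, continuous (fun q => u (zoom q) - k)}.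
  move=> p1; have -> : (fun q => u (zoom q) - k) = (fun q => 1 * u (zoom q) - k).
    by apply/funext => q; rewrite mul1r.
  apply: continuous_zoom.
  move: cu; rewrite continuous_open_subspace// => /(_ (zoom p)); apply.
  exact/mem_set/(zoom_eball sub).
have dist2 p q : enorm (zoom q - zoom p) ^+ 2 = d ^+ 2 * enorm (q - p) ^+ 2.
  by rewrite zoomB enormZ exprMn real_normK ?num_real.
have scaleX (X : 'M[R]_n.+1) : X^T = X -> (d^-1 ^+ 2 *: X)^T = d^-1 ^+ 2 *: X.
  by move=> XT; rewrite linearZ /= XT.
have dV : 0 < d^-1 ^+ 2 by rewrite exprn_gt0// invr_gt0.
have d2 : 0 < d ^+ 2 by rewrite exprn_gt0.
have dV2 : d ^+ 2 * d^-1 ^+ 2 = 1 by rewrite -exprMn divff ?gt_eqF// expr1n.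
split; first by rewrite continuous_open_subspace//;
  [move=> p /set_mem; exact: cw | exact: open_eball].
- split=> [p p1 e e0|p p1 xi X XT jet].
    have /continuous_enormP/(_ (e / 2)) := cw p p1; rewrite divr_gt0//.
    move=> /(_ isT)[r r0 hr]; apply/nbhs_enormP; exists r => // y yp _.
    have := hr y yp; rewrite ler_norml => /andP[]; lra.
  have := subu _ (zoom_eball sub p1) (d^-1 *: xi) _ (scaleX _ XT).
  rewrite Mop_scale// => /(_ _)/(ler_wpM2l (ltW d2)).
  rewrite mulrA dV2 mul1r; apply => e e0.
  have := near_zoom (jet (e * d ^+ 2) (mulr_gt0 e0 d2)).
  apply: filterS => y; set q := d^-1 *: (y - x).
  by rewrite -(quadr_zoom p q) -mulrA -dist2 /q zoomK; lra.
- split=> [p p1 e e0|p p1 xi X XT jet].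
    have /continuous_enormP/(_ (e / 2)) := cw p p1; rewrite divr_gt0//.
    move=> /(_ isT)[r r0 hr]; apply/nbhs_enormP; exists r => // y yp _.
    have := hr y yp; rewrite ler_norml => /andP[]; lra.
  have := supu _ (zoom_eball sub p1) (d^-1 *: xi) _ (scaleX _ XT).
  rewrite Mop_scale// => /(_ _)/(ler_wpM2l (ltW d2)).
  rewrite mulrA dV2 mul1r; apply => e e0.
  have := near_zoom (jet (e * d ^+ 2) (mulr_gt0 e0 d2)).
  apply: filterS => y; set q := d^-1 *: (y - x).
  by rewrite -(quadr_zoom p q) -mulrA -dist2 /q zoomK; lra.
Qed.

(** The inequality in [interior_exponent], for a given constant. *)
Definition interior_estimate (astar atilde alpha C0 : R) :=
  forall (a : 'I_n.+1 -> R) (x0 : 'rV[R]_n.+1) (w h : 'rV[R]_n.+1 -> R),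
    class_A a -> min_weight a = astar -> mean_weight a = atilde ->
    bounded_continuous (eball x0 1) h ->
    viscosity_solution a (eball x0 1) h w ->
    (holder_norm alpha (closed_eball x0 2^-1) w <=
     C0%:E * (Lnorm_on +oo (eball x0 1) w +
              Lnorm_on n.+1%:R%:E (eball x0 1) h))%E.

Lemma rescaled_interior_estimate (astar atilde alpha C0 F M k : R)
    (a : 'I_n.+1 -> R) Omega f u :
  interior_estimate astar atilde alpha C0 -> 0 < C0 ->
  class_A a -> min_weight a = astar -> mean_weight a = atilde ->
  open Omega -> bounded_continuous Omega f -> viscosity_solution a Omega f u ->
  0 <= F -> (forall y, Omega y -> `|f y| <= F) ->
  eball x d `<=` Omega -> (forall y, eball x d y -> `|u y - k| <= M) ->
  forall y, enorm (y - x) <= d / 2 ->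
    `|u y - u x| <= C0 * (M + 2 * (d ^+ 2 * F)) * (enorm (y - x) / d) `^ alpha.
Proof.
move=> est C00 aA amin amean oO [cf _] sol F0 fF sub uM y yx.
have M0 : 0 <= M.
  by apply: le_trans (uM x _) => //; rewrite /eball /= subrr enorm0.
have d2F : 0 <= d ^+ 2 * F by rewrite mulr_ge0// exprn_ge0// ltW.
have [->|ynx] := eqVneq y x.
  rewrite subrr normr0 mulr_ge0 ?powR_ge0// mulr_ge0 ?(ltW C00)//.
  by rewrite addr_ge0// mulr_ge0.
pose w p := u (zoom p) - k; pose h p := d ^+ 2 * f (zoom p).
have solw : viscosity_solution a (eball 0 1) h w.
  exact: (viscosity_solution_rescale k oO sub sol).
have hM p : eball 0 1 p -> `|h p| <= d ^+ 2 * F.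
  move=> p1; rewrite /h normrM ger0_norm ?exprn_ge0 ?(ltW d0)//.
  by rewrite ler_wpM2l ?exprn_ge0 ?(ltW d0)//; apply: fF; exact: (zoom_eball sub).
have wM p : eball 0 1 p -> `|w p| <= M.
  by move=> p1; apply: uM; exact: (zoom_eball (fun=> id)).
have bch : bounded_continuous (eball 0 1) h.
  split.
    rewrite continuous_open_subspace; last exact: open_eball.
    move=> p /set_mem p1.
    have -> : h = (fun q => d ^+ 2 * f (zoom q) - 0).
      by apply/funext => q; rewrite subr0.
    apply: continuous_zoom.
    move: cf; rewrite continuous_open_subspace// => /(_ (zoom p)); apply.
    exact/mem_set/(zoom_eball sub).
  exists (d ^+ 2 * F); split; first by rewrite num_real.
  by move=> r rF p p1; apply: le_trans (hM p p1) (ltW rF).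
have := est a 0 w h aA amin amean bch solw.
have hn : (Lnorm_on n.+1%:R%:E (eball 0 1) h <= (2 * (d ^+ 2 * F))%:E)%E.
  exact: Lnorm_on_unit_ball_le.
have wn : (Lnorm_on +oo (eball 0 1) w <= M%:E)%E by exact: Lnorm_on_pinfty_le.
have C0e : (0 <= C0%:E)%E by rewrite lee_fin ltW.
move=> /le_trans/(_ (lee_wpmul2l C0e (leeD wn hn))).
rewrite -EFinD -EFinM => {}est.
pose q := d^-1 *: (y - x).
have qE : enorm q = enorm (y - x) / d.
  by rewrite /q enormZ gtr0_norm ?invr_gt0// mulrC.
have q0 : 0 < enorm q.
  by rewrite qE divr_gt0// enorm_gt0 subr_eq0.
have qhalf : closed_eball 0 2^-1 q.
  by rewrite /closed_eball /= subr0 qE ler_pdivrMr// mulrC.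
have zhalf : closed_eball (0 : 'rV[R]_n.+1) 2^-1 0.
  by rewrite /closed_eball /= subrr enorm0.
have semi : ((`|w q - w 0| / enorm (q - 0) `^ alpha)%:E <=
    holder_norm alpha (closed_eball 0 2^-1) w)%E.
  rewrite -[leLHS]add0e /holder_norm; apply: leeD.
    apply: le_trans (ereal_sup_ubound _); last by exists 0.
    by rewrite lee_fin.
  apply: ereal_sup_ubound; exists (q, 0) => //; split => //=.
  by rewrite -enorm_gt0.
have := le_trans semi est; rewrite lee_fin subr0 ler_pdivrMr ?powR_gt0//.
rewrite qE /w /q zoomK /zoom scaler0 addr0.
by rewrite opprB addrA subrK.
Qed.

End rescaling.
End interior.
Arguments interior_estimate {R} n astar atilde alpha C0.

(** * From the boundary to the closure *)

Section global_estimate.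
Context {R : realType} {n : nat}.
Implicit Types (u f g : 'rV[R]_n.+1 -> R) (Omega : set 'rV[R]_n.+1).

Lemma powR_le_lower_exponent (t B g k : R) : 0 <= t <= B -> 0 < g -> g <= k ->
  t `^ k <= B `^ (k - g) * t `^ g.
Proof.
move=> /andP[t0 tB] g0 gk; have [->|tn0] := eqVneq t 0.
  rewrite powR0 ?mulr_ge0 ?powR_ge0//; lra.
have -> : t `^ k = t `^ (k - g) * t `^ g.
  by rewrite -powRD ?tn0 ?implybT// subrK.
rewrite ler_wpM2r ?powR_ge0// ge0_ler_powR ?nnegrE ?subr_ge0//.
exact: le_trans tB.
Qed.

Lemma powRM_le (t c k : R) : 0 <= t -> 1 <= c -> 0 <= k -> k <= 1 ->
  (c * t) `^ k <= c * t `^ k.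
Proof.
move=> t0 c1 k0 k1; have c0 : 0 <= c by lra.
rewrite (powRM _ c0 t0) ler_wpM2r ?powR_ge0// -[leRHS](powRr1 c0).
exact: ler_powR.
Qed.

(** The first summand bounds both cases, a far and a near second point, in terms
    of the boundary seminorm; the second one is the effect of the right-hand
    side, of order d^2 on a ball of radius d. *)
Definition patching_cst (C0 D gam k : R) : R :=
  (6 + 2 * C0) * (2 * D) `^ (k - gam) + 2 * C0 * (2 * D) `^ (2 - gam).

(** The interior estimate is used in the largest ball around a point when the
    other point is close with respect to the distance d to the boundary, and
    the boundary estimate otherwise.  In the first case the oscillation of u
    on the ball is of order d^k, which compensates the factor d^(- alpha) that
    comes from rescaling, since alpha may be lowered to gam <= k. *)
Lemma holder_of_boundary_holder (astar atilde alpha C0 F K D k : R)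
    (a : 'I_n.+1 -> R) Omega f u :
  interior_estimate n astar atilde alpha C0 -> 0 < C0 -> 0 < alpha ->
  0 < k <= 1 -> 0 <= K -> 0 <= F -> 0 < D ->
  class_A a -> min_weight a = astar -> mean_weight a = atilde ->
  open Omega -> ~` Omega !=set0 ->
  bounded_continuous Omega f -> viscosity_solution a Omega f u ->
  (forall y, Omega y -> `|f y| <= F) ->
  (forall z y, boundary Omega z -> closure Omega y ->
    enorm (y - z) <= D /\ `|u y - u z| <= K * enorm (y - z) `^ k) ->
  forall x y, closure Omega x -> closure Omega y ->
    `|u x - u y| <= patching_cst C0 D (Num.min alpha k) k * (K + F) *
                    enorm (x - y) `^ (Num.min alpha k).
Proof.
move=> est C00 al0 /andP[k0 k1] K0 F0 D0 aA amin amean oO [p0 nOp0] bcf sol fF bd.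
have : Num.min alpha k <= alpha by rewrite ge_min lexx.
have : Num.min alpha k <= k by rewrite ge_min lexx orbT.
have : 0 < Num.min alpha k by rewrite lt_min al0.
move: (Num.min alpha k) => gam g0 gk gal.
have g2 : gam <= 2 by lra.
have [E1 E1E] : exists E, E = (2 * D) `^ (k - gam) by eexists.
have [E2 E2E] : exists E, E = (2 * D) `^ (2 - gam) by eexists.
have E10 : 0 <= E1 by rewrite E1E; exact: powR_ge0.
have E20 : 0 <= E2 by rewrite E2E; exact: powR_ge0.
have cstE : patching_cst C0 D gam k = (6 + 2 * C0) * E1 + 2 * C0 * E2.
  by rewrite E1E E2E.
have cst6 (t : R) : 0 <= t -> 6 * E1 * K * t <= patching_cst C0 D gam k * (K + F) * t.
  move=> t0; rewrite ler_wpM2r// cstE.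
  have h1 := mulr_ge0 (ltW C00) E10; have h2 := mulr_ge0 (ltW C00) E20.
  have := mulr_ge0 h1 K0; have := mulr_ge0 h2 K0; have := mulr_ge0 h1 F0.
  have := mulr_ge0 h2 F0; have := mulr_ge0 E10 F0; lra.
have bdry z y : boundary Omega z -> closure Omega y ->
    `|u y - u z| <= patching_cst C0 D gam k * (K + F) * enorm (y - z) `^ gam.
  move=> zB cy; have [yzD yz] := bd z y zB cy.
  apply: le_trans yz _; apply: le_trans (cst6 _ (powR_ge0 _ _)).
  have : enorm (y - z) `^ k <= E1 * enorm (y - z) `^ gam.
    rewrite E1E; apply: powR_le_lower_exponent => //; apply/andP; split => //.
    by clear - yzD D0; lra.
  move=> /(ler_wpM2l K0)/le_trans; apply.
  have := mulr_ge0 (mulr_ge0 K0 E10) (powR_ge0 (enorm (y - z)) gam); lra.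
move=> x y cx cy.
have [Ox|nOx] := pselect (Omega x); last first.
  by rewrite distrC enormB; apply: bdry => //; apply/boundaryP.
have [Oy|nOy] := pselect (Omega y); last first.
  by apply: bdry => //; apply/boundaryP.
have [z zB sub] := nearest_boundary_point oO Ox nOp0.
have [d dE] : exists d, d = enorm (z - x) by eexists.
have [xzD xz] := bd z x zB cx; have [yzD yz] := bd z y zB cy.
rewrite enormB -dE in xzD xz; rewrite -dE in sub.
have d0 : 0 < d.
  rewrite dE enorm_gt0 subr_eq0; apply/eqP => zx.
  by have [_] := (boundaryP _ oO).1 zB; rewrite zx.
have one_le2 : 1 <= 2 :> R by rewrite ler1n.
have one_le3 : 1 <= 3 :> R by rewrite ler1n.
have [t tE'] : exists t, t = enorm (x - y) by eexists.
have t0 : 0 <= t by rewrite tE'.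
rewrite -tE'; have [near|far] := leP t (d / 2); last first.
  have d3 : d <= 3 * t by clear - far t0; lra.
  have yz3 : enorm (y - z) <= 3 * t.
    have := enorm_dist_triangle x y z; rewrite (enormB y x) (enormB x z) -tE' -dE.
    by clear - far t0; lra.
  have tD : 0 <= t <= 2 * D.
    rewrite t0; have := enorm_dist_triangle z x y.
    by rewrite (enormB x z) (enormB z y) -tE' -dE; clear - xzD yzD; lra.
  apply: le_trans (cst6 _ (powR_ge0 _ _)).
  have h1 : d `^ k <= 3 * t `^ k.
    apply: le_trans (powRM_le t0 one_le3 (ltW k0) k1).
    by rewrite ge0_ler_powR ?nnegrE ?(ltW k0) ?(ltW d0) ?mulr_ge0.
  have h2 : enorm (y - z) `^ k <= 3 * t `^ k.
    apply: le_trans (powRM_le t0 one_le3 (ltW k0) k1).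
    by rewrite ge0_ler_powR ?nnegrE ?(ltW k0) ?mulr_ge0.
  have h3 := ler_wpM2l K0 (powR_le_lower_exponent tD g0 gk).
  have h4 := ler_wpM2l K0 h1; have h5 := ler_wpM2l K0 h2.
  have -> : u x - u y = (u x - u z) - (u y - u z) by ring.
  apply: le_trans (ler_normB _ _) _.
  apply: le_trans (lerD (le_trans xz h4) (le_trans yz h5)) _.
  rewrite -E1E in h3; clear - h3.
  move: (t `^ k) (t `^ gam) h3 => tk tg; lra.
have [M ME] : exists M, M = 2 * (K * d `^ k) by eexists.
have uM w : eball x d w -> `|u w - u z| <= M.
  move=> wx; have [_ wz] := bd z w zB (subset_closure (sub w wx)).
  apply: le_trans wz _; rewrite ME mulrCA; apply: (ler_wpM2l K0).
  apply: le_trans (powRM_le (ltW d0) one_le2 (ltW k0) k1).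
  apply: ge0_ler_powR; rewrite ?nnegrE ?(ltW k0) ?mulr_ge0 ?(ltW d0)//.
  have := enorm_dist_triangle x w z; rewrite (enormB x z) -dE.
  by move: wx; rewrite /eball /=; clear; lra.
have yx : enorm (y - x) <= d / 2 by rewrite enormB -tE'.
have := rescaled_interior_estimate d0 est C00 aA amin amean oO bcf sol F0 fF
  sub uM yx.
rewrite distrC enormB -tE' => /le_trans; apply.
clear - C00 K0 F0 D0 d0 ME xzD near t0 g0 gk gal g2 E10 E20 E1E E2E cstE.
have [s sE] : exists s, s = t / d by eexists.
have s0 : 0 <= s by rewrite sE divr_ge0 ?(ltW d0).
have tE : t `^ gam = s `^ gam * d `^ gam.
  by rewrite -powRM ?(ltW d0)// sE divfK// gt_eqF.
have sal : s `^ alpha <= s `^ gam.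
  have [->|sn0] := eqVneq s 0.
    by rewrite !powR0 ?gt_eqF// (lt_le_trans g0).
  apply: ger_powR => //; rewrite lt_neqAle eq_sym sn0 s0 /=.
  rewrite sE ler_pdivrMr// mul1r; lra.
have dD : 0 <= d <= 2 * D by apply/andP; split; lra.
have dk : d `^ k <= E1 * d `^ gam.
  by rewrite E1E; exact: powR_le_lower_exponent.
have d2 : d ^+ 2 <= E2 * d `^ gam.
  by rewrite E2E -powR_mulrn ?(ltW d0)//; exact: powR_le_lower_exponent.
rewrite -sE tE ME.
have dg0 : 0 <= d `^ gam by exact: powR_ge0.
have dk0 : 0 <= d `^ k by exact: powR_ge0.
have sg0 : 0 <= s `^ gam by exact: powR_ge0.
have dd0 : 0 <= d ^+ 2 by exact: sqr_ge0.
rewrite cstE; clear - C00 K0 F0 E10 E20 sal dk d2 dg0 dk0 sg0 dd0.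
move: (d `^ gam) (d `^ k) (s `^ gam) (s `^ alpha) (d ^+ 2) sal dk d2 dg0 dk0 sg0 dd0.
move=> dg dk sg sa dd sal hdk hd2 dg0 dk0 sg0 dd0.
have M0 : 0 <= C0 * (2 * (K * dk) + 2 * (dd * F)).
  by rewrite !(mulr_ge0, addr_ge0)// ltW.
apply: (@le_trans _ _ (C0 * (2 * (K * dk) + 2 * (dd * F)) * sg)).
  exact: ler_wpM2l.
rewrite [leRHS](_ : _ =
  ((6 + 2 * C0) * E1 + 2 * C0 * E2) * (K + F) * dg * sg); last by ring.
apply: (ler_wpM2r sg0).
have h1 := ler_wpM2l (ltW C00) (ler_wpM2l K0 hdk).
have h2 := ler_wpM2l (ltW C00) (ler_wpM2l F0 hd2).
have h3 : 0 <= E1 * dg by rewrite mulr_ge0.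
have h4 : 0 <= E2 * dg by rewrite mulr_ge0.
have h5 := mulr_ge0 h3 (addr_ge0 K0 F0).
have h6 := mulr_ge0 (mulr_ge0 (ltW C00) h3) F0.
have h7 := mulr_ge0 (mulr_ge0 (ltW C00) h4) K0.
lra.
Qed.

Section boundary_values.
Context (astar atilde alpha C0 F K Q rad k : R) (a : 'I_n.+1 -> R)
  Omega f u.
Hypotheses (est : interior_estimate n astar atilde alpha C0) (C00 : 0 < C0)
  (al0 : 0 < alpha) (k01 : 0 < k <= 1) (K0 : 0 <= K) (Q0 : 0 <= Q)
  (F0 : 0 <= F) (r0 : 0 < rad) (astar0 : 0 < astar).
Hypotheses (aA : class_A a) (amin : min_weight a = astar)
  (amean : mean_weight a = atilde) (bO : bounded_domain Omega)
  (cO : compact (closure Omega)) (bcf : bounded_continuous Omega f)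
  (cu : {within closure Omega, continuous u})
  (sol : viscosity_solution a Omega f u)
  (fF : forall y, Omega y -> `|f y| <= F) (on : has_outer_normals rad Omega).

(** The coefficient of the bound F of the right-hand side in the barrier. *)
Definition barrier_cst : R := 2 * rad * (2 * rad) `^ (1 - k) / (2 * astar).

Definition global_cst : R := patching_cst C0 (2 * rad) (Num.min alpha k) k *
  (3 + barrier_cst + (2 * rad) `^ (1 - k)).

Lemma global_cst_ge0 : 0 <= global_cst.
Proof.
have h x y : 0 <= x `^ y := powR_ge0 x y.
have C0' := ltW C00; have r0' := ltW r0; have a0' := ltW astar0.
rewrite /global_cst /patching_cst /barrier_cst.
by rewrite !(invr_ge0, mulr_ge0, addr_ge0, h).
Qed.

Lemma solution_not_touched (c : R) : F / (2 * astar) < c ->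
  not_touched Omega u c /\ not_touched Omega (\- u) c.
Proof.
rewrite ltr_pdivrMr ?mulr_gt0// => Fc; have [_ sub super] := sol.
have c0 : 0 <= c.
  rewrite leNgt; apply/negP => c0; have : c * (2 * astar) < 0.
    by rewrite nmulr_rlt0// mulr_gt0.
  by move=> h; have := lt_trans Fc h; rewrite ltNge F0.
have a1 : astar <= a ord0 by rewrite -amin /min_weight ge_min lexx.
have an : astar <= a ord_max by rewrite -amin /min_weight ge_min lexx orbT.
split.
  apply: (subsolution_not_touched sub fF c0).
  have := ler_wpM2l c0 a1; lra.
apply: (supersolution_not_touched super fF c0).
have := ler_wpM2l c0 an; lra.
Qed.

(** In both parts of the theorem the boundary values are, near each boundary
    point, within K height^k of an affine function: the constant g(y) in the
    first one, the first order expansion of g in the second one. *)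
Lemma holder_of_affine_boundary_trap :
  (forall y nu, boundary Omega y -> outer_normal rad Omega y nu ->
    exists p q, [/\ u y = p + dotp q y, enorm q <= Q &
      forall x, boundary Omega x ->
        `|u x - (p + dotp q x)| <= K * dotp nu (y - x) `^ k]) ->
  forall x y, closure Omega x -> closure Omega y ->
    `|u x - u y| <= global_cst * (K + Q + F) *
                    enorm (x - y) `^ (Num.min alpha k).
Proof.
move=> trap x y cx cy; have [oO _ O0 bdO] := bO.
have [k0 k1] := andP k01; have r2 : 0 < 2 * rad by rewrite mulr_gt0.
have [D' D'E] : exists D', D' = 2 * rad * (2 * rad) `^ (1 - k) by eexists.
have D'0 : 0 <= D' by rewrite D'E mulr_ge0 ?powR_ge0// ltW.
have [c0 c0E] : exists c0, c0 = F / (2 * astar) by eexists.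
have c00 : 0 <= c0 by rewrite c0E divr_ge0// ltW// mulr_gt0.
have [E EE] : exists E, E = (2 * rad) `^ (1 - k) by eexists.
have E0 : 0 <= E by rewrite EE powR_ge0.
have [K1 K1E] : exists K1, K1 = 2 * K + c0 * D' + Q * E by eexists.
have K10 : 0 <= K1 by rewrite K1E !addr_ge0// !mulr_ge0.
have bd z w : boundary Omega z -> closure Omega w ->
    enorm (w - z) <= 2 * rad /\ `|u w - u z| <= K1 * enorm (w - z) `^ k.
  move=> zB cw; have [nu onu] := on zB.
  have dw := dist_le_diam r0 onu cw; split => //.
  have [p [q [uz qQ ub]]] := trap z nu zB onu.
  have nt c : c0 < c -> not_touched Omega u c /\ not_touched Omega (\- u) c.
    by rewrite c0E; exact: solution_not_touched.
  have := two_sided_barrier r0 k01 K0 c00 oO cO cu nt onu zB ub cw.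
  rewrite -D'E => h.
  have hd : dotp nu (z - w) `^ k <= enorm (w - z) `^ k.
    rewrite ge0_ler_powR ?nnegrE ?(ltW k0) ?(height_ge0 r0 onu)//.
    exact: height_le_dist onu w.
  have A0 : 0 <= 2 * K + c0 * D' by rewrite addr_ge0 ?mulr_ge0.
  have h1 := ler_wpM2l A0 hd.
  have h2 : `|dotp q (w - z)| <= Q * (E * enorm (w - z) `^ k).
    apply: le_trans (norm_dotp_le _ _) _; rewrite ler_pM// EE.
    rewrite -[leLHS]powRr1//; apply: powR_le_lower_exponent => //.
    by rewrite enorm_ge0 dw.
  have -> : u w - u z = (u w - (p + dotp q w)) + dotp q (w - z).
    by rewrite uz dotpBr; ring.
  apply: le_trans (ler_normD _ _) _.
  apply: le_trans (lerD (le_trans h h1) h2) _; rewrite K1E.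
  by rewrite mulrA -mulrDl.
have nO : ~` Omega !=set0.
  have [b [_ [bB _ _]]] := boundary_two_points oO O0 bdO.
  by exists b; have [] := (boundaryP _ oO).1 bB.
have := holder_of_boundary_holder est C00 al0 k01 K10 F0 r2 aA amin amean oO nO
  bcf sol fF bd cx cy.
move=> /le_trans; apply; rewrite ler_wpM2r ?powR_ge0// /global_cst -mulrA.
have P0 : 0 <= patching_cst C0 (2 * rad) (Num.min alpha k) k.
  have h v w : 0 <= v `^ w := powR_ge0 v w.
  have C0' := ltW C00.
  by rewrite /patching_cst !(mulr_ge0, addr_ge0, h).
rewrite ler_wpM2l// K1E.
have -> : c0 * D' = F * barrier_cst.
  by rewrite c0E /barrier_cst -D'E; ring.
have b0 : 0 <= barrier_cst.
  by rewrite /barrier_cst -D'E divr_ge0// ltW// mulr_gt0.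
rewrite -EE; move: (barrier_cst) b0 => b b0.
have := mulr_ge0 K0 b0; have := mulr_ge0 Q0 b0; have := mulr_ge0 K0 E0.
have := mulr_ge0 F0 E0; have := K0; have := Q0; have := F0; lra.
Qed.

End boundary_values.
End global_estimate.

Section holder_norms.
Context {R : realType} {n : nat}.
Implicit Types (h : 'rV[R]_n.+1 -> R) (D : set 'rV[R]_n.+1).
Local Open Scope ereal_scope.

Lemma holder_seminorm_le (V : zmodType) (N : V -> R) (gam B : R) D
    (h : 'rV[R]_n.+1 -> V) :
  (forall x y, D x -> D y -> (N (h x - h y) <= B * enorm (x - y) `^ gam)%R) ->
  holder_seminorm N gam D h <= B%:E.
Proof.
move=> hB; apply: ge_ereal_sup => _ [[x y] /= [Dx Dy xy] <-].
rewrite lee_fin ler_pdivrMr ?powR_gt0//; first exact: hB.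
by rewrite enorm_gt0 subr_eq0.
Qed.

Lemma le_of_holder_seminorm (V : zmodType) (N : V -> R) (gam B : R) D
    (h : 'rV[R]_n.+1 -> V) x y : holder_seminorm N gam D h <= B%:E ->
  D x -> D y -> x != y -> (N (h x - h y) <= B * enorm (x - y) `^ gam)%R.
Proof.
move=> hB Dx Dy xy; rewrite -ler_pdivrMr; last first.
  by rewrite powR_gt0// enorm_gt0 subr_eq0.
rewrite -lee_fin; apply: le_trans hB.
by apply: ereal_sup_ubound; exists (x, y).
Qed.

Lemma holder_seminorm_ge0 (V : zmodType) (N : V -> R) (gam : R) D
    (h : 'rV[R]_n.+1 -> V) : (forall v, 0 <= N v)%R ->
  (exists x y, [/\ D x, D y & x != y]) -> 0 <= holder_seminorm N gam D h.
Proof.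
move=> N0 [x [y [Dx Dy xy]]].
apply: (@le_trans _ _ (N (h x - h y) / enorm (x - y) `^ gam)%:E).
  by rewrite lee_fin divr_ge0// powR_ge0.
by apply: ereal_sup_ubound; exists (x, y).
Qed.

Lemma sup_norm_le (V : zmodType) (N : V -> R) (B : R) D (h : 'rV[R]_n.+1 -> V) :
  (forall x, D x -> (N (h x) <= B)%R) -> sup_norm N D h <= B%:E.
Proof. by move=> hB; apply: ge_ereal_sup => _ [x Dx <-]; rewrite lee_fin hB. Qed.

Lemma le_sup_norm (V : zmodType) (N : V -> R) D (h : 'rV[R]_n.+1 -> V) x :
  D x -> (N (h x))%:E <= sup_norm N D h.
Proof. by move=> Dx; apply: ereal_sup_ubound; exists x. Qed.

Lemma sup_norm_ge0 (V : zmodType) (N : V -> R) D (h : 'rV[R]_n.+1 -> V) :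
  (forall v, 0 <= N v)%R -> D !=set0 -> 0 <= sup_norm N D h.
Proof.
move=> N0 [x Dx]; apply: le_trans (le_sup_norm N h Dx).
by rewrite lee_fin.
Qed.

Lemma compact_sup_norm_lt_pinfty (V : normedModType R) D
    (h : 'rV[R]_n.+1 -> V) (N : V -> R) (c : R) :
  (forall v, (N v <= c * `|v|)%R) -> (0 <= c)%R ->
  compact D -> {within D, continuous h} -> sup_norm N D h < +oo.
Proof.
move=> Nc c0 cD ch; have [M [_ hM]] := compact_bounded (continuous_compact ch cD).
apply: (@le_lt_trans _ _ (c * (`|M| + 1))%:E); last by rewrite ltry.
apply: sup_norm_le => x Dx; apply: le_trans (Nc _) _; rewrite ler_wpM2l//.
apply: (hM (`|M| + 1)%R); last by exists x.
by rewrite (le_lt_trans (ler_norm _))// ltrDl.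
Qed.

Lemma holder_norm_lt_pinfty (gam B : R) D h : compact D ->
  {within D, continuous h} ->
  (forall x y, D x -> D y -> (`|h x - h y| <= B * enorm (x - y) `^ gam)%R) ->
  holder_norm gam D h < +oo.
Proof.
move=> cD ch hB; apply: lte_add_pinfty.
  by apply: (@compact_sup_norm_lt_pinfty _ _ _ _ 1) => // v; rewrite mul1r.
by apply: le_lt_trans (holder_seminorm_le hB) _; rewrite ltry.
Qed.

Lemma compact_closure_bounded D : bounded_set D -> compact (closure D).
Proof.
move=> [M [Mr hM]]; apply: bounded_closed_compact; last exact: closed_closure.
exists M; split => // r Mr' x /closure_enormP cx; apply/ler_addgt0Pr => e e0.
have [y Dy yx] := cx e e0; have yr := hM r Mr' y Dy.
rewrite -[x](subrK y) addrC; apply: le_trans (ler_normD _ _) _.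
rewrite lerD// (le_trans (norm_le_enorm _))// enormB; exact: ltW.
Qed.

Lemma compact_boundary D : open D -> compact (closure D) -> compact (boundary D).
Proof.
move=> oD cD; apply: (subclosed_compact _ cD); last by move=> x [].
rewrite (_ : boundary D = closure D `&` ~` D); last first.
  by apply/seteqP; split => x; rewrite (boundaryP _ oD).
by apply: closedI; [exact: closed_closure | exact: open_closedC].
Qed.

End holder_norms.

(** * Finiteness of the norms of the data *)

Section data.
Context {R : realType} {n : nat}.
Implicit Types (f u g : 'rV[R]_n.+1 -> R) (Omega : set 'rV[R]_n.+1).

Lemma min_weight_gt0 (a : 'I_n.+1 -> R) : class_A a -> 0 < min_weight a.
Proof. by case=> _ a1 an; rewrite /min_weight lt_min a1. Qed.

Lemma Lnorm_on_data Omega f : open Omega -> bounded_continuous Omega f ->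
  exists F : R, [/\ 0 <= F, Lnorm_on +oo Omega f = F%:E &
    forall y, Omega y -> `|f y| <= F].
Proof.
move=> oO [cf [M [Mr hM]]].
have fM y : Omega y -> `|f y| <= `|M| + 1.
  by apply: hM; rewrite (le_lt_trans (ler_norm _))// ltrDl.
have L0 : (0 <= Lnorm_on +oo Omega f)%E by exact: Lnorm_ge0.
have Lfin : Lnorm_on +oo Omega f \is a fin_num.
  rewrite ge0_fin_numE//.
  by rewrite (le_lt_trans (Lnorm_on_pinfty_le _ fM)) ?ltry// addr_ge0.
exists (fine (Lnorm_on +oo Omega f)); split; first exact: fine_ge0.
  by rewrite fineK.
by move=> y Oy; rewrite -lee_fin fineK//; exact: Lnorm_on_pinfty_ge.
Qed.

Lemma holder_norm_data (beta : R) D g :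
  (exists x y, [/\ D x, D y & x != y]) -> (holder_norm beta D g < +oo)%E ->
  exists G : R, [/\ 0 <= G, holder_norm beta D g = G%:E &
    forall x y, D x -> D y -> x != y ->
      `|g x - g y| <= G * enorm (x - y) `^ beta].
Proof.
move=> D2 gfin; have [x0 [_ [Dx0 _ _]]] := D2.
have s0 : (0 <= sup_norm Num.norm D g)%E by apply: sup_norm_ge0 => //; exists x0.
have h0 : (0 <= holder_seminorm Num.norm beta D g)%E by exact: holder_seminorm_ge0.
have N0 : (0 <= holder_norm beta D g)%E by exact: adde_ge0.
have Nfin : holder_norm beta D g \is a fin_num by rewrite ge0_fin_numE.
exists (fine (holder_norm beta D g)); split; first exact: fine_ge0.
  by rewrite fineK.
move=> x y; apply: le_of_holder_seminorm; rewrite fineK//.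
by rewrite /holder_norm leeDr.
Qed.

Lemma C1_holder_norm_data (beta : R) D g :
  compact D -> (exists x y, [/\ D x, D y & x != y]) ->
  {within D, continuous g} -> C1_holder_near beta D g ->
  exists N : R, [/\ 0 <= N, C1_holder_norm beta D g = N%:E,
    forall x, D x -> `|g x| <= N,
    forall x, D x -> enorm (grad g x) <= N &
    forall x y, D x -> D y ->
      enorm (grad g x - grad g y) <= N * enorm (x - y) `^ beta].
Proof.
move=> cD D2 cg [U [_ DU _ cgrad hU]]; have [x0 [_ [Dx0 _ _]]] := D2.
have D0 : D !=set0 by exists x0.
set A := sup_norm Num.norm D g; set B := sup_norm (@enorm R n.+1) D (grad g).
set H := holder_seminorm (@enorm R n.+1) beta D (grad g).
have A0 : (0 <= A)%E by exact: sup_norm_ge0.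
have B0 : (0 <= B)%E by apply: sup_norm_ge0 => // v; exact: enorm_ge0.
have H0 : (0 <= H)%E by apply: holder_seminorm_ge0 => // v; exact: enorm_ge0.
have NE : C1_holder_norm beta D g = (A + B + H)%E by [].
have AB0 : (0 <= A + B)%E by exact: adde_ge0.
have N0 : (0 <= C1_holder_norm beta D g)%E by rewrite NE adde_ge0.
have Hlt : (H < +oo)%E.
  apply: le_lt_trans hU; apply: ge_ereal_sup => _ [[x y] /= [Dx Dy xy] <-].
  by apply: ereal_sup_ubound; exists (x, y) => //; split => //; exact: DU.
have Alt : (A < +oo)%E.
  by apply: (@compact_sup_norm_lt_pinfty _ _ _ _ _ _ 1) => // v; rewrite mul1r.
have Blt : (B < +oo)%E.
  apply: (@compact_sup_norm_lt_pinfty _ _ _ _ _ _ n.+1%:R) => //.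
    exact: enorm_le_norm.
  exact: continuous_subspaceW cgrad.
have Nfin : C1_holder_norm beta D g \is a fin_num.
  by rewrite ge0_fin_numE// NE !lte_add_pinfty.
have leA : (A <= C1_holder_norm beta D g)%E.
  by rewrite NE -addeA leeDl// adde_ge0.
have leB : (B <= C1_holder_norm beta D g)%E.
  by rewrite NE addeAC leeDr// adde_ge0.
have leH : (H <= C1_holder_norm beta D g)%E by rewrite NE leeDr.
exists (fine (C1_holder_norm beta D g)); split; first exact: fine_ge0.
- by rewrite fineK.
- by move=> x Dx; rewrite -lee_fin fineK//; apply: le_trans leA; exact: le_sup_norm.
- by move=> x Dx; rewrite -lee_fin fineK//; apply: le_trans leB;
    exact: (le_sup_norm (@enorm R n.+1)).
- move=> x y Dx Dy; have [->|xy] := eqVneq x y.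
    by rewrite subrr enorm0 mulr_ge0 ?powR_ge0 ?fine_ge0.
  by apply: (le_of_holder_seminorm _ Dx Dy xy); rewrite fineK.
Qed.

(** m + 1 instead of m, since the constant has to be positive. *)
Lemma holder_conclusion (gam B m N F : R) Omega u : 0 <= N -> 0 <= F ->
  compact (closure Omega) -> {within closure Omega, continuous u} ->
  (forall x y, closure Omega x -> closure Omega y ->
    `|u x - u y| <= B * enorm (x - y) `^ gam) -> B <= m * (N + F) ->
  (holder_norm gam (closure Omega) u < +oo)%E /\
  (holder_seminorm Num.norm gam Omega u <= (m + 1)%:E * (N%:E + F%:E))%E.
Proof.
move=> N0 F0 cO cu hu Bm; split; first exact: holder_norm_lt_pinfty hu.
rewrite -EFinD -EFinM; apply: holder_seminorm_le => x y Ox Oy.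
apply: le_trans (hu _ _ (subset_closure Ox) (subset_closure Oy)) _.
rewrite ler_wpM2r ?powR_ge0// mulrDl mul1r.
by rewrite (le_trans Bm)// lerDl addr_ge0.
Qed.

End data.

(** * Global Hölder estimates *)

Unset Implicit Arguments.
Set Strict Implicit.
Set Printing Implicit Defensive.

Theorem theorem1p3 (R : realType) (n : nat) (astar atilde alpha : R) :
  interior_exponent n astar atilde alpha ->
  (forall rad beta : R, 0 < rad -> 0 < beta -> beta <= 1 ->
    exists C : R, 0 < C /\
      forall (a : 'I_n.+1 -> R) (Omega : set 'rV[R]_n.+1)
             (f u g : 'rV[R]_n.+1 -> R),
        class_A a -> min_weight a = astar -> mean_weight a = atilde ->
        bounded_domain Omega ->
        bounded_continuous Omega f ->
        {within closure Omega, continuous u} ->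
        viscosity_solution a Omega f u ->
        exterior_sphere rad Omega ->
        (forall x, boundary Omega x -> u x = g x) ->
        (holder_norm beta (boundary Omega) g < +oo)%E ->
        let gamma := Num.min alpha (beta / 2) in
        (holder_norm gamma (closure Omega) u < +oo)%E /\
        (holder_seminorm Num.norm gamma Omega u <=
         C%:E * (holder_norm beta (boundary Omega) g +
                 Lnorm_on +oo Omega f))%E)
  /\
  ((0 < n)%N ->
   forall rad L beta : R, 0 < rad -> 0 <= L -> 0 <= beta -> beta < 1 ->
    exists C : R, 0 < C /\
      forall (a : 'I_n.+1 -> R) (Omega : set 'rV[R]_n.+1)
             (f u g : 'rV[R]_n.+1 -> R),
        class_A a -> min_weight a = astar -> mean_weight a = atilde ->
        bounded_domain Omega ->
        bounded_continuous Omega f ->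
        {within closure Omega, continuous u} ->
        viscosity_solution a Omega f u ->
        exterior_sphere rad Omega ->
        uniform_lipschitz_boundary L Omega ->
        (forall x, boundary Omega x -> u x = g x) ->
        C1_holder_near beta (boundary Omega) g ->
        let gamma := Num.min alpha ((1 + beta) / 2) in
        (holder_norm gamma (closure Omega) u < +oo)%E /\
        (holder_seminorm Num.norm gamma Omega u <=
         C%:E * (C1_holder_norm beta (boundary Omega) g +
                 Lnorm_on +oo Omega f))%E).
Proof.
case=> [/andP[al0 _] [C0 [C00 est]]].
have [astar_le0|astar0] := leP astar 0.
  have void (a : 'I_n.+1 -> R) : class_A a -> min_weight a = astar -> False.
    by move=> /min_weight_gt0 + aE; rewrite aE ltNge astar_le0.
  split=> [rad beta _ _ _|_ rad L beta _ _ _ _]; exists 1; split => //.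
    by move=> a Omega f u g /void h /h.
  by move=> a Omega f u g /void h /h.
split=> [rad beta r0 b0 b1|n0 rad L beta r0 _ b0 b1].
- set k := beta / 2; have k01 : 0 < k <= 1.
    by rewrite divr_gt0//= ler_pdivrMr// mul1r (le_trans b1)// ler1n.
  set gc := global_cst astar alpha C0 rad k.
  have gc0 : 0 <= gc by exact: global_cst_ge0.
  pose m := gc * ((2 * rad) `^ k + 1).
  have m0 : 0 <= m by rewrite mulr_ge0// addr_ge0// powR_ge0.
  exists (m + 1); split; first by rewrite ltr_wpDl.
  move=> a Omega f u g aA amin amean bO bcf cu sol es ug gfin /=.
  have [oO _ O0 bdO] := bO.
  have cO := compact_closure_bounded bdO.
  have [F [F0 -> fF]] := Lnorm_on_data oO bcf.
  have [G [G0 -> gG]] := holder_norm_data (boundary_two_points oO O0 bdO) gfin.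
  have on : has_outer_normals rad Omega by move=> y; exact: outer_normalP.
  have K0 : 0 <= G * (2 * rad) `^ k by rewrite mulr_ge0 ?powR_ge0.
  have := holder_of_affine_boundary_trap est C00 al0 k01 K0 (lexx 0) F0 r0 astar0
    aA amin amean bO cO bcf cu sol fF on.
  rewrite -/gc => hol.
  apply: (holder_conclusion G0 F0 cO cu (hol _)); last first.
    rewrite /m -[leRHS]mulrA ler_wpM2l// addr0.
    have := mulr_ge0 F0 (powR_ge0 (2 * rad) k); lra.
  move=> y nu yB onu; exists (u y), 0; split; rewrite ?dotp0l ?addr0 ?enorm0//.
  move=> x xB; rewrite dotp0l addr0 !ug//.
  have [->|xy] := eqVneq x y.
    by rewrite subrr normr0 mulr_ge0 ?powR_ge0.
  apply: le_trans (gG x y xB yB xy) _; rewrite -mulrA ler_wpM2l//.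
  have h0 := height_ge0 r0 onu xB.1.
  rewrite -powRM ?mulr_ge0 ?(ltW r0)//.
  rewrite (_ : _ `^ beta = (enorm (x - y) ^+ 2) `^ k).
    apply: ge0_ler_powR; rewrite ?nnegrE ?sqr_ge0//.
    - by case/andP: k01 => /ltW.
    - by rewrite !mulr_ge0// ltW.
    - exact: onu.2 xB.1.
  by rewrite -powR_mulrn// -powRrM /k mulrC divfK.
- set k := (1 + beta) / 2; have k01 : 0 < k <= 1.
    by rewrite divr_gt0 ?ltr_wpDr//= ler_pdivrMr//; lra.
  set gc := global_cst astar alpha C0 rad k.
  have gc0 : 0 <= gc by exact: global_cst_ge0.
  have ec0 := expansion_cst_ge0 beta r0.
  pose m := gc * (expansion_cst rad beta + 1).
  have m0 : 0 <= m by rewrite mulr_ge0// addr_ge0.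
  exists (m + 1); split; first by rewrite ltr_wpDl.
  move=> a Omega f u g aA amin amean bO bcf cu sol es _ ug gC1 /=.
  have [oO _ O0 bdO] := bO.
  have cO := compact_closure_bounded bdO.
  have [F [F0 -> fF]] := Lnorm_on_data oO bcf.
  have dg p : boundary Omega p -> differentiable g p.
    by case: gC1 => U [_ BU dU _ _] pB; exact/dU/BU.
  have cg : {within boundary Omega, continuous g}.
    apply: continuous_in_subspaceT => p /set_mem pB.
    exact/differentiable_continuous/dg.
  have [N [N0 -> gN gradN gradH]] := C1_holder_norm_data (compact_boundary oO cO)
    (boundary_two_points oO O0 bdO) cg gC1.
  have on : has_outer_normals rad Omega by move=> y; exact: outer_normalP.
  have K0 : 0 <= expansion_cst rad beta * N by rewrite mulr_ge0.
  have := holder_of_affine_boundary_trap est C00 al0 k01 K0 N0 F0 r0 astar0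
    aA amin amean bO cO bcf cu sol fF on.
  rewrite -/gc => hol.
  apply: (holder_conclusion N0 F0 cO cu (hol _)); last first.
    rewrite /m -[leRHS]mulrA ler_wpM2l//; have := mulr_ge0 F0 ec0; lra.
  move=> y nu yB onu; exists (g y - dotp (grad g y) y), (grad g y).
  split; [by rewrite ug// subrK | exact: gradN |] => x xB.
  have -> : g y - dotp (grad g y) y + dotp (grad g y) x =
      g y + dotp (grad g y) (x - y) by rewrite dotpBr; ring.
  rewrite ug//.
  exact: (boundary_expansion r0 b0 b1 N0 oO cO O0 on dg gN gradN gradH n0).
Qed.
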